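(* Let $X_1$ and $X_2$ be two jointly measurable Gaussian processes with Green's functions $G_1$ and $G_2$ and covariance kernels $K_i=G_i\square G_i^*$. Assume that $G_1^*\square G_2\succeq0$ and $\mathcal N(\mathscr K_{G_1})\subset\mathcal N(\mathscr K_{G_2})$. Then $X_1\leadsto X_2$, and an optimal pre-pushforward is given by $$\mathbf T:\mathbb H(K_1)\to\mathbb H(K_2),\qquad\mathscr K_{G_1}f\mapsto\mathscr K_{G_2}f,\quad f\in\mathcal H.$$
   Context: $E$ is a compact set with a finite measure $\mu$, and $\mathcal H=L_2(E,\mu)$ (real, separable). For $G\in L_2(E\times E,\mu\times\mu)$, $(\mathscr K_Gf)(s)=\int_EG(s,t)f(t)\,d\mu(t)$; $G^*(s,t)=G(t,s)$; $(G\square H)(s,t)=\int_EG(s,u)H(u,t)\,d\mu(u)$, so that $\mathscr K_{G\square H}=\mathscr K_G\mathscr K_H$ and $\mathscr K_{G^*}=\mathscr K_G^*$. A kernel is $\succeq0$ if its integral operator is self-adjoint and positive semidefinite. $\mathcal N,\mathcal R$ denote null space and range. The (centered) Gaussian process $X_i$ on $E$ has covariance kernel $K_i$, and a Green's function for it is $G_i$ with $K_i=G_i\square G_i^*$; its covariance operator is $\mathscr K_{K_i}$, and $\mathbb H(K_i)=\mathcal R(\mathscr K_{G_i})=\mathcal R(\mathscr K_{K_i}^{1/2})$. For covariance (positive semidefinite trace-class) operators $\mathbf A,\mathbf B$ on $\mathcal H$, an optimal pre-pushforward from $\mathbf A$ to $\mathbf B$ is a (possibly unbounded) linear operator $\mathbf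 T:\mathcal R(\mathbf A^{1/2})\subset\overline{\mathcal R(\mathbf A)}\to\mathcal H$ with $(\mathbf T\mathbf A^{1/2})(\mathbf T\mathbf A^{1/2})^*=\mathbf B$ and $\operatorname{tr}(\mathbf A^{1/2}\mathbf T\mathbf A^{1/2})=\operatorname{tr}(\mathbf T\mathbf A)=\operatorname{tr}[(\mathbf A^{1/2}\mathbf B\mathbf A^{1/2})^{1/2}]$. $X_1\leadsto X_2$ means that one exists for $\mathbf A=\mathscr K_{K_1}$, $\mathbf B=\mathscr K_{K_2}$. *)

(* Defs.v *)
From HB Require Import structures.
From mathcomp Require Import all_boot all_order all_algebra.
From mathcomp Require Import all_classical all_reals all_analysis.
From mathcomp Require Import measurable_realfun.

Set Implicit Arguments.
Unset Strict Implicit.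
Unset Printing Implicit Defensive.

Import Order.TTheory GRing.Theory Num.Theory.
Import numFieldNormedType.Exports.

Local Open Scope classical_set_scope.
Local Open Scope ring_scope.

Notation L2 mu := (LspaceType mu (lee1n 2)).

(* The library's Lebesgue space (classes of square-integrable functions modulo
   equality almost everywhere) carries no algebraic structure: it is made into
   an R-module here, the operations being those of representatives. *)
Section L2_lmodule.
Context d (T : measurableType d) (R : realType).
Variable mu : {measure set T -> \bar R}.
Local Notation L := (L2 mu).
Local Notation F := (LfunType mu (lee1n 2)).
Local Notation M := {mfun_ mu, T >-> measurableTypeR R}.

Lemma L2_Lfun (u : L) : (u : T -> R) \in Lfun mu 2%:E.
Proof.
rewrite inE; apply/andP; split.
  by rewrite inE; exact: measurable_funPT (repr (u : M)).
by rewrite inE; exact: Lebesgue_finite.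
Qed.

Definition L2_repr (u : L) : F := Lfun_Sub (lee1n 2) (L2_Lfun u).

Definition Lfun_mfun (f : F) : {mfun T >-> measurableTypeR R} :=
  HB.pack_for {mfun T >-> measurableTypeR R} (f : T -> measurableTypeR R)
    (@isMeasurableFun.Build _ _ T (measurableTypeR R) f (measurable_funPT f)).

Definition L2_mclass (f : F) : M := \pi_M%qT (Lfun_mfun f).

Lemma L2_mclassE (f : F) : (L2_mclass f : T -> R) = f %[ae mu].
Proof. by have /eqmodP/asboolP := reprK (L2_mclass f). Qed.

Lemma L2_mclass_finite (f : F) : finite_norm mu 2%:E (L2_mclass f).
Proof.
have : finite_norm mu 2%:E f by [].
rewrite /finite_norm; suff -> : Lnorm mu 2%:E (EFin \o f) =
   Lnorm mu 2%:E (EFin \o (L2_mclass f : T -> R)) by [].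
rewrite unlock; congr (_ `^ _)%E.
have mabs (g : T -> R) : measurable_fun [set: T] g ->
    measurable_fun [set: T] (fun x => (`|g x| `^ 2)%:E : \bar R).
  move=> mg; apply/measurable_EFinP.
  by apply: (measurableT_comp (measurable_powR 2)); exact: measurableT_comp.
apply: ge0_ae_eq_integral => //=.
- by apply: mabs; exact: measurable_funPT.
- by apply: mabs; exact: (measurable_funPT (repr (L2_mclass f))).
move: (L2_mclassE f); apply: filterS => x h /h ->; exact: erefl.
Qed.

Definition L2_class (f : F) : L :=
  HB.pack_for L (L2_mclass f)
    (@isFinLebesgue.Build d T R mu 2%:E (lee1n 2) (L2_mclass f) (L2_mclass_finite f)).

Lemma L2_classE (f : F) : (L2_class f : T -> R) = f %[ae mu].
Proof. exact: L2_mclassE. Qed.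

Lemma L2_eqP (u v : L) : u = v <-> \forall x \ae mu, u x = v x.
Proof.
split=> [->|uv]; first exact: nearW.
have E : (u : M) = (v : M).
  rewrite -[LHS]reprK -[RHS]reprK; apply/eqmodP/asboolP.
  by move: uv; apply: filterS.
case: u v E {uv} => [f [[hf]]] [g [[hg]]] /= E.
by case: _ / E in hg *; congr (LebesgueSpace.Pack (LebesgueSpace.Class _));
  congr (isFinLebesgue.phant_Build _ _); exact: bool_irrelevance.
Qed.

HB.instance Definition _ := gen_eqMixin L.
HB.instance Definition _ := gen_choiceMixin L.

Definition L2_zero : L := L2_class 0.
Definition L2_opp (u : L) : L := L2_class (- L2_repr u).
Definition L2_add (u v : L) : L := L2_class (L2_repr u + L2_repr v).
Definition L2_scale (a : R) (u : L) : L := L2_class (a *: L2_repr u).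

Lemma L2_class_ae (f : F) : \forall x \ae mu, L2_class f x = f x.
Proof. by move: (L2_classE f); apply: filterS => x; exact. Qed.

Lemma L2_addE (u v : L) : \forall x \ae mu, L2_add u v x = u x + v x.
Proof. exact: L2_class_ae. Qed.

Lemma L2_oppE (u : L) : \forall x \ae mu, L2_opp u x = - u x.
Proof. exact: L2_class_ae. Qed.

Lemma L2_scaleE a (u : L) : \forall x \ae mu, L2_scale a u x = a * u x.
Proof. exact: L2_class_ae. Qed.

Lemma L2_zeroE : \forall x \ae mu, L2_zero x = 0.
Proof. exact: L2_class_ae. Qed.

Let addA : associative L2_add.
Proof.
move=> u v w; apply/L2_eqP; near=> x.
rewrite (near (L2_addE u (L2_add v w)) x)// (near (L2_addE v w) x)//.
rewrite (near (L2_addE (L2_add u v) w) x)// (near (L2_addE u v) x)//.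
by rewrite addrA.
Unshelve. all: by end_near. Qed.

Let addC : commutative L2_add.
Proof.
move=> u v; apply/L2_eqP; near=> x.
by rewrite (near (L2_addE u v) x)// (near (L2_addE v u) x)// addrC.
Unshelve. all: by end_near. Qed.

Let add0 : left_id L2_zero L2_add.
Proof.
move=> u; apply/L2_eqP; near=> x.
by rewrite (near (L2_addE L2_zero u) x)// (near L2_zeroE x)// add0r.
Unshelve. all: by end_near. Qed.

Let addN : left_inverse L2_zero L2_opp L2_add.
Proof.
move=> u; apply/L2_eqP; near=> x.
rewrite (near (L2_addE (L2_opp u) u) x)// (near (L2_oppE u) x)//.
by rewrite (near L2_zeroE x)// addNr.
Unshelve. all: by end_near. Qed.

HB.instance Definition _ := GRing.isZmodule.Build L addA addC add0 addN.

Let scaleA a b u : L2_scale a (L2_scale b u) = L2_scale (a * b) u.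
Proof.
apply/L2_eqP; near=> x.
rewrite (near (L2_scaleE a (L2_scale b u)) x)// (near (L2_scaleE b u) x)//.
by rewrite (near (L2_scaleE (a * b) u) x)// mulrA.
Unshelve. all: by end_near. Qed.

Let scale1 : left_id 1 L2_scale.
Proof.
move=> u; apply/L2_eqP; near=> x.
by rewrite (near (L2_scaleE 1 u) x)// mul1r.
Unshelve. all: by end_near. Qed.

Let scaleDr : right_distributive L2_scale +%R.
Proof.
move=> a u v; apply/L2_eqP; near=> x.
rewrite (near (L2_scaleE a (u + v)) x)// (near (L2_addE u v) x)//.
rewrite (near (L2_addE (L2_scale a u) (L2_scale a v)) x)//.
rewrite (near (L2_scaleE a u) x)// (near (L2_scaleE a v) x)//.
by rewrite mulrDr.
Unshelve. all: by end_near. Qed.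

Let scaleDl u : {morph L2_scale^~ u : a b / a + b}.
Proof.
move=> a b; apply/L2_eqP; near=> x.
rewrite (near (L2_scaleE (a + b) u) x)//.
rewrite (near (L2_addE (L2_scale a u) (L2_scale b u)) x)//.
rewrite (near (L2_scaleE a u) x)// (near (L2_scaleE b u) x)//.
by rewrite mulrDl.
Unshelve. all: by end_near. Qed.

HB.instance Definition _ := GRing.Zmodule_isLmodule.Build R L
  scaleA scale1 scaleDr scaleDl.

End L2_lmodule.

Definition L2_inner d (T : measurableType d) (R : realType)
    (mu : {measure set T -> \bar R}) (f g : L2 mu) : R :=
  \int[mu]_x (f x * g x).

Section operators.
Context (R : realType) (H : lmodType R) (ip : H -> H -> R).

Definition hnorm (x : H) : R := Num.sqrt (ip x x).

Definition separable_space : Prop :=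
  exists2 D : set H, countable D &
    forall (x : H) (e : R), 0 < e -> exists2 y, D y & hnorm (x - y) < e.

Definition linear_on (D : set H) (M : H -> H) : Prop :=
  forall (a : R) x y, D x -> D y -> M (a *: x + y) = a *: M x + M y.

Definition bounded_op (M : H -> H) : Prop :=
  linear_on setT M /\ exists c : R, forall x, hnorm (M x) <= c * hnorm x.

Definition is_adjoint (M N : H -> H) : Prop :=
  forall x y, ip (M x) y = ip x (N y).

Definition psd_op (M : H -> H) : Prop :=
  [/\ bounded_op M, is_adjoint M M & forall x, 0 <= ip (M x) x].

(* A positive semidefinite bounded operator on a Hilbert space has exactly one
   positive semidefinite square root; the default value is irrelevant. *)
Definition sqrt_op (M : H -> H) : H -> H :=
  xget (fun=> 0) [set S | psd_op S /\ S \o S = M].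

(* Orthonormal bases of a separable space, indexed by nat: a finite basis is
   padded with zero vectors. *)
Definition onb (e : nat -> H) : Prop :=
  [/\ forall i, e i = 0 \/ ip (e i) (e i) = 1,
      forall i j, i != j -> ip (e i) (e j) = 0 &
      forall x, (forall i, ip x (e i) = 0) -> x = 0].

(* The trace norm tr((M^* M)^(1/2)) is finite; it does not depend on the basis
   in which it is computed. *)
Definition trace_class (M : H -> H) : Prop :=
  bounded_op M /\
  exists N e, [/\ is_adjoint M N, onb e &
    cvgn (series (fun n => ip (sqrt_op (N \o M) (e n)) (e n)))].

Definition has_trace (M : H -> H) (t : R) : Prop :=
  trace_class M /\
  forall e, onb e -> series (fun n => ip (M (e n)) (e n)) @ \oo --> t.

Definition covariance_op (A : H -> H) : Prop := psd_op A /\ trace_class A.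

(* The (possibly unbounded) linear operator with domain D is the restriction
   to D of M; the values of M outside D play no role. The first adjoint is
   required to be defined everywhere, as the operator B is. *)
Definition optimal_prepushforward (A B : H -> H) (D : set H) (M : H -> H) :
    Prop :=
  let A12 := sqrt_op A in
  [/\ covariance_op A /\ covariance_op B,
      D = range A12,
      linear_on D M,
      exists2 N, is_adjoint (M \o A12) N & (M \o A12) \o N = B &
      exists t, [/\ has_trace (A12 \o M \o A12) t,
                    has_trace (M \o A) t &
                    has_trace (sqrt_op (A12 \o B \o A12)) t]].

End operators.

Section square_integrable.
Context d (T : measurableType d) (R : realType).
Variable mu : {measure set T -> \bar R}.
Local Open Scope ereal_scope.

Lemma Lnorm2_sqr (f : T -> R) :
  'N[mu]_2[EFin \o f] `^ 2 = \int[mu]_x (f x ^+ 2)%:E.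
Proof.
rewrite powR_Lnorm//; apply: eq_integral => x _ /=.
by rewrite powR_mulrn// real_normK// num_real.
Qed.

Lemma Lfun2P (f : T -> R) : f \in Lfun mu 2%:E <->
  measurable_fun [set: T] f /\ \int[mu]_x (f x ^+ 2)%:E < +oo.
Proof.
rewrite -Lnorm2_sqr; split.
  rewrite inE => /andP[]; rewrite !inE/= /finite_norm => mf nf; split => //.
  exact: poweR_lty.
move=> [mf nf]; rewrite inE; apply/andP; split; rewrite inE//=.
by apply: (@lty_poweRy _ _ 2) nf.
Qed.

Lemma Rintegral_cauchy_schwarz (f g : T -> R) :
  measurable_fun [set: T] f -> measurable_fun [set: T] g ->
  (((\int[mu]_x (f x * g x)) ^+ 2)%R)%:E <=
  \int[mu]_x (f x ^+ 2)%:E * \int[mu]_x (g x ^+ 2)%:E.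
Proof.
move=> mf mg; rewrite -!Lnorm2_sqr -poweRM ?Lnorm_ge0//.
rewrite -real_normK ?num_real// -powR_mulrn// -poweR_EFin.
rewrite gt0_ler_poweR ?in_itv/= ?leey ?andbT ?lee_fin ?mule_ge0 ?Lnorm_ge0 ?normr_ge0//.
have H : ('N[mu]_1[EFin \o (f \* g)%R] <=
    'N[mu]_2[EFin \o f] * 'N[mu]_2[EFin \o g])%E.
  by apply: hoelder => //; rewrite [RHS]splitr !div1r.
apply: le_trans H.
rewrite Lnorm1; apply: le_trans (le_abse_integral _ _ _) => //=.
  rewrite /Rintegral; case: (\int[mu]_x _) => //=.
  - by rewrite normr0 leey.
  - by rewrite normr0 leey.
by apply/measurable_EFinP; exact: measurable_funM.
Qed.

End square_integrable.

Section Rintegral_section.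
Context d1 d2 (T1 : measurableType d1) (T2 : measurableType d2) (R : realType).
Variable m2 : {sigma_finite_measure set T2 -> \bar R}.

Lemma measurable_Rintegral2 (F : T1 * T2 -> R) :
  measurable_fun [set: T1 * T2] F ->
  measurable_fun [set: T1] (fun x => \int[m2]_y F (x, y)).
Proof.
move=> mF; apply: measurableT_comp => //.
have mF' : measurable_fun [set: T1 * T2] (EFin \o F) by exact/measurable_EFinP.
under eq_fun do rewrite integralE.
apply: emeasurable_funB.
- have Q := @measurable_fun_fubini_tonelli_F _ _ T1 T2 R m2
    (funepos (EFin \o F)) (measurable_funepos mF') (funepos_ge0 _).
  by rewrite unlock in Q *; exact: Q.
- have Q := @measurable_fun_fubini_tonelli_F _ _ T1 T2 R m2
    (funeneg (EFin \o F)) (measurable_funeneg mF') (funeneg_ge0 _).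
  by rewrite unlock in Q *; exact: Q.
Qed.

End Rintegral_section.

(* Kernels are square-integrable functions on the square, not classes of such,
   because a covariance kernel is defined pointwise. *)
Notation L2kernel mu := (LfunType (mu \x mu)%E (lee1n 2)).

Section integral_operators.
Context d (E : measurableType d) (R : realType).
Variable mu : {finite_measure set E -> \bar R}.
Implicit Types (G H : L2kernel mu).

Let sqr_int G : (\int[mu \x mu]_z ((G z) ^+ 2)%:E < +oo)%E.
Proof. by have /Lfun2P[] := LfunP G. Qed.

Let msqr d' (T : measurableType d') (g : T -> R) :
  measurable_fun [set: T] g ->
  measurable_fun [set: T] (fun z => (g z ^+ 2)%:E).
Proof. by move=> mg; apply/measurable_EFinP; exact: measurable_funX. Qed.

Let sqr_ge0 (T : Type) (g : T -> R) z : (0 <= (g z ^+ 2)%:E)%E.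
Proof. by rewrite lee_fin sqr_ge0. Qed.

Let msqr1 G :
  measurable_fun [set: E] (fun s => \int[mu]_t (G (s, t) ^+ 2)%:E)%E.
Proof.
exact: (@measurable_fun_fubini_tonelli_F _ _ E E R mu
  (fun z => (G z ^+ 2)%:E) (msqr (measurable_funPT G)) (sqr_ge0 G)).
Qed.

Let msqr2 G :
  measurable_fun [set: E] (fun t => \int[mu]_s (G (s, t) ^+ 2)%:E)%E.
Proof.
exact: (@measurable_fun_fubini_tonelli_G _ _ E E R mu
  (fun z => (G z ^+ 2)%:E) (msqr (measurable_funPT G)) (sqr_ge0 G)).
Qed.

Let int_sqr1 G : (\int[mu]_s \int[mu]_t (G (s, t) ^+ 2)%:E =
  \int[mu \x mu]_z (G z ^+ 2)%:E)%E.
Proof.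
by rewrite (fubini_tonelli1 (fun z => (G z ^+ 2)%:E) (msqr (measurable_funPT G))
  (sqr_ge0 G)).
Qed.

Let int_sqr2 G : (\int[mu]_t \int[mu]_s (G (s, t) ^+ 2)%:E =
  \int[mu \x mu]_z (G z ^+ 2)%:E)%E.
Proof.
by rewrite -int_sqr1 (fubini_tonelli (fun z => (G z ^+ 2)%:E)
  (msqr (measurable_funPT G)) (sqr_ge0 G)).
Qed.

Lemma integral_fun_Lfun G (f : L2 mu) :
  (fun s => \int[mu]_t (G (s, t) * f t)) \in Lfun mu 2%:E.
Proof.
have /Lfun2P[mf if2] := L2_Lfun f.
apply/Lfun2P; split.
  apply: (@measurable_Rintegral2 _ _ _ _ _ _ (fun z => G z * f z.2)) => //.
  by apply: measurable_funM => //; exact: measurableT_comp.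
apply: (@le_lt_trans _ _ (\int[mu]_s
  (\int[mu]_t (G (s, t) ^+ 2)%:E * \int[mu]_t (f t ^+ 2)%:E))%E).
  apply: ge0_le_integral => //.
  - apply: msqr; apply: (@measurable_Rintegral2 _ _ _ _ _ _ (fun z => G z * f z.2)) => //.
    by apply: measurable_funM => //; exact: measurableT_comp.
  - by apply: emeasurable_funM; [exact: msqr1|exact: measurable_cst].
  - by move=> s _; apply: Rintegral_cauchy_schwarz => //; exact: measurableT_comp.
rewrite ge0_integralZr ?integral_ge0//.
- by rewrite int_sqr1 lte_mul_pinfty ?integral_ge0 ?ge0_fin_numE ?integral_ge0.
- by move=> s _; exact: integral_ge0.
Qed.

Definition int_op G (f : L2 mu) : L2 mu :=
  L2_class (Lfun_Sub (lee1n 2) (integral_fun_Lfun G f)).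

Lemma kernel_adj_Lfun G : (fun z => G (z.2, z.1)) \in Lfun (mu \x mu)%E 2%:E.
Proof.
have mG := measurable_funPT G.
have mG' : measurable_fun [set: E * E] (fun z : E * E => G (z.2, z.1)).
  by apply: (measurableT_comp mG); exact: measurable_swap.
apply/Lfun2P; split => //.
rewrite (fubini_tonelli1 (fun z : E * E => (G (z.2, z.1) ^+ 2)%:E) (msqr mG'))//.
by rewrite /fubini_F /= int_sqr2.
Qed.

Definition kernel_adj G : L2kernel mu :=
  Lfun_Sub (lee1n 2) (kernel_adj_Lfun G).

Lemma kernel_comp_Lfun G H :
  (fun z => \int[mu]_u (G (z.1, u) * H (u, z.2))) \in Lfun (mu \x mu)%E 2%:E.
Proof.
have mG := measurable_funPT G; have mH := measurable_funPT H.
have mI : measurable_fun [set: E * E]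
    (fun z : E * E => \int[mu]_u (G (z.1, u) * H (u, z.2))).
  apply: (@measurable_Rintegral2 _ _ _ _ _ _
    (fun w : (E * E) * E => G (w.1.1, w.2) * H (w.2, w.1.2))).
  apply: measurable_funM.
    by apply: (measurableT_comp mG); apply: measurable_fun_pair => //;
      exact: measurableT_comp.
  by apply: (measurableT_comp mH); apply: measurable_fun_pair => //;
    exact: measurableT_comp.
apply/Lfun2P; split => //.
pose A s : \bar R := (\int[mu]_u (G (s, u) ^+ 2)%:E)%E.
pose B t : \bar R := (\int[mu]_u (H (u, t) ^+ 2)%:E)%E.
have mA : measurable_fun [set: E] A by exact: msqr1.
have mB : measurable_fun [set: E] B by exact: msqr2.
have A0 s : (0 <= A s)%E by exact: integral_ge0.
have B0 t : (0 <= B t)%E by exact: integral_ge0.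
have AE : (\int[mu]_s A s)%E = (\int[mu \x mu]_z (G z ^+ 2)%:E)%E.
  exact: int_sqr1.
have BE : (\int[mu]_s B s)%E = (\int[mu \x mu]_z (H z ^+ 2)%:E)%E.
  exact: int_sqr2.
apply: (@le_lt_trans _ _ (\int[mu \x mu]_z (A z.1 * B z.2))%E).
  apply: ge0_le_integral => //.
  - exact: msqr.

  - by apply: emeasurable_funM; exact: measurableT_comp.
  - move=> z _; apply: Rintegral_cauchy_schwarz.
      exact: (measurableT_comp mG).
    exact: (measurableT_comp mH).
rewrite fubini_tonelli1//; last 2 first.
- by apply: emeasurable_funM; exact: measurableT_comp.
- by move=> z; rewrite mule_ge0.
rewrite /fubini_F /=; under eq_integral do rewrite ge0_integralZl//.
rewrite ge0_integralZr ?integral_ge0// AE BE.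
by rewrite lte_mul_pinfty ?integral_ge0 ?ge0_fin_numE ?sqr_int ?integral_ge0.
Qed.

Definition kernel_comp G H : L2kernel mu :=
  Lfun_Sub (lee1n 2) (kernel_comp_Lfun G H).

End integral_operators.

(* An identity of elements of L_2(E x E), hence almost everywhere. *)
Definition is_green d (E : measurableType d) (R : realType)
    (mu : {finite_measure set E -> \bar R}) (K G : L2kernel mu) : Prop :=
  \forall z \ae (mu \x mu)%E, K z = kernel_comp G (kernel_adj G) z.

Definition leadsto d (E : measurableType d) (R : realType)
    (mu : {finite_measure set E -> \bar R}) (K1 K2 : L2kernel mu) : Prop :=
  exists (D : set (L2 mu)) (M : L2 mu -> L2 mu),
    optimal_prepushforward (@L2_inner _ _ _ mu) (int_op K1) (int_op K2) D M.

Section gaussian_processes.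
Context d (T : measurableType d) (R : realType) (P : probability T R).

(* [normal_prob m s] is the normal law of variance s ^+ 2 only for s != 0. *)
Definition gaussian_law (Y : T -> R) : Prop :=
  exists m s : R, forall A : set R, measurable A ->
    P (Y @^-1` A) = if s == 0 then \d_m A else normal_prob m s A.

Definition gaussian_process d' (E : measurableType d') (X : E -> T -> R)
    (K : E * E -> R) : Prop :=
  [/\ measurable_fun [set: E * T] (fun z => X z.1 z.2),
      forall (n : nat) (t : 'I_n -> E) (a : 'I_n -> R),
        gaussian_law (fun w => \sum_(i < n) a i * X (t i) w),
      forall s, ('E_P[X s] = 0)%E &
      forall s t, covariance P (X s) (X t) = (K (s, t))%:E].

End gaussian_processes.

(* A topological space with its Borel sigma-algebra. *)
Notation borel E := (g_sigma_algebraType (@open E)).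

(* Main.v *)
(** Write A_i for the integral operator of G_i, so that the covariance operators
    are A_i A_i^*, and let S be the square root of A_1 A_1^*. Since S and A_1^*
    have the same Gram form, there is a partial isometry U with U S = A_1^* and
    U^* A_1^* = S; hence A_1 = S U^*, S = A_1 U, and S and A_1 have the same range.
    As U U^* differs from the identity only on N(A_1), which lies in N(A_2),
    A_2 U U^* = A_2. The operator T with T A_1 = A_2 thus satisfies T S = A_2 U,
    so (T S)(T S)^* = A_2 A_2^*, and S T S = U^* (A_1^* A_2) U is positive
    semidefinite with square S A_2 A_2^* S. Finally the traces of S T S = S (A_2 U)
    and of T S^2 = A_2 A_1^* = (A_2 U) S agree, as those of the two products of the
    Hilbert-Schmidt operators S and A_2 U. *)

Require Import Defs.
From HB Require Import structures.
From mathcomp Require Import all_boot all_order all_algebra.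
From mathcomp Require Import all_classical all_reals all_analysis.
From mathcomp Require Import measurable_realfun.
From mathcomp Require Import ring lra.

Set Implicit Arguments.
Unset Strict Implicit.
Unset Printing Implicit Defensive.

Import Order.TTheory GRing.Theory Num.Theory.
Import numFieldNormedType.Exports.

Local Open Scope classical_set_scope.
Local Open Scope ring_scope.

(** T is in general unbounded and need not have an adjoint; its compositions are therefore rewritten
    at once through the everywhere defined operators A_2 and A_2 U. No spectral theory enters.
    Square roots are limits of a polynomial iteration, and their uniqueness is what identifies S T S
    with the root whose trace is required. U comes from one Gram-Schmidt process, run on a dense
    sequence for S and A_1^* at once. Traces are reduced by polarization to sums of squares |A
    e_i|^2, and the independence of the basis becomes an exchange of two nonnegative sums. That S is
    Hilbert-Schmidt is read off S = A_1 U. *)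

Definition ip_cvg (R : realType) (H : lmodType R) (ip : H -> H -> R)
    (u : nat -> H) (l : H) : Prop :=
  hnorm ip (u n - l) @[n --> \oo] --> (0 : R).

(** [H] is only a module, without a topology, so completeness refers to the norm derived from
    [ip]. *)
Record hilbert_ip (R : realType) (H : lmodType R) (ip : H -> H -> R) : Prop :=
  HilbertIp {
    hilbertC : forall x y, ip x y = ip y x;
    hilbertPl : forall a x y z, ip (a *: x + y) z = a * ip x z + ip y z;
    hilbert_ge0 : forall x, 0 <= ip x x;
    hilbert_eq0 : forall x, ip x x = 0 -> x = 0;
    hilbert_complete : forall u : nat -> H,
      (forall e : R, 0 < e -> exists N, forall m n, (N <= m)%N -> (N <= n)%N ->
        hnorm ip (u m - u n) < e) ->
      exists l, ip_cvg ip u l }.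

(** The form may be degenerate: besides [ip], the lemma serves for [ip (S x) y] with [S] positive
    semidefinite. *)
Lemma form_cauchy_schwarz (R : realType) (H : lmodType R) (b : H -> H -> R) :
  (forall x y, b x y = b y x) ->
  (forall a x y z, b (a *: x + y) z = a * b x z + b y z) ->
  (forall x, 0 <= b x x) ->
  forall x y, b x y ^+ 2 <= b x x * b y y.
Proof.
move=> bC bP b0 x y.
have E a : b (a *: x + y) (a *: x + y) = a ^+ 2 * b x x + 2 * a * b x y + b y y.
  by rewrite bP (bC x) (bC y) !bP (bC y x); ring.
have [x0|x0] := eqVneq (b x x) 0.
  rewrite x0 mul0r; have [->|xy] := eqVneq (b x y) 0; first by rewrite expr0n.
  (* When [b x x = 0] the square is affine in the coefficient; this one makes it -1. *)
  have := b0 ((- (b y y + 1) / (2 * b x y)) *: x + y).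
  rewrite E x0 mulr0 add0r.
  have -> : 2 * (- (b y y + 1) / (2 * b x y)) * b x y = - (b y y + 1) by field.
  by move=> ?; exfalso; lra.
have xp : 0 < b x x by rewrite lt_def x0 b0.
have := b0 ((- b x y / b x x) *: x + y); rewrite E.
have -> : (- b x y / b x x) ^+ 2 * b x x + 2 * (- b x y / b x x) * b x y + b y y
   = (b x x * b y y - b x y ^+ 2) / b x x by field.
by rewrite pmulr_lge0 ?invr_gt0// subr_ge0.
Qed.

Lemma cvgR_unique (R : realType) (u : nat -> R) (a b : R) :
  u n @[n --> \oo] --> a -> u n @[n --> \oo] --> b -> a = b.
Proof. by move=> ua ub; rewrite -(cvg_lim _ ua)// -(cvg_lim _ ub). Qed.

Lemma cvgR_le (R : realType) (u v : nat -> R) (a b : R) :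
  u n @[n --> \oo] --> a -> v n @[n --> \oo] --> b -> (forall n, u n <= v n) ->
  a <= b.
Proof.
move=> ua vb uv; rewrite -(cvg_lim _ ua)// -(cvg_lim _ vb)//.
apply: ler_lim; [exact: cvgP ua|exact: cvgP vb|exact: nearW].
Qed.

(** * Geometry of a real Hilbert space *)

Section hilbert.
Context (R : realType) (H : lmodType R) (ip : H -> H -> R).
Context (hH : hilbert_ip ip).
Local Notation "'nrm x" := (hnorm ip x) (at level 10, x at level 8).

Lemma ipC x y : ip x y = ip y x. Proof. exact: hilbertC. Qed.
Lemma ipDl x y z : ip (x + y) z = ip x z + ip y z.
Proof. by rewrite -[x in LHS]scale1r (hilbertPl hH) mul1r. Qed.
Lemma ip0l z : ip 0 z = 0.
Proof. by apply: (addIr (ip 0 z)); rewrite -ipDl !add0r. Qed.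
Lemma ipZl a x z : ip (a *: x) z = a * ip x z.
Proof. by rewrite -[a *: x]addr0 (hilbertPl hH) ip0l addr0. Qed.
Lemma ipNl x z : ip (- x) z = - ip x z.
Proof. by rewrite -scaleN1r ipZl mulN1r. Qed.
Lemma ipBl x y z : ip (x - y) z = ip x z - ip y z.
Proof. by rewrite ipDl ipNl. Qed.
Lemma ipDr x y z : ip z (x + y) = ip z x + ip z y.
Proof. by rewrite ipC ipDl !(ipC z). Qed.
Lemma ip0r z : ip z 0 = 0.
Proof. by rewrite ipC ip0l. Qed.
Lemma ipZr a x z : ip z (a *: x) = a * ip z x.
Proof. by rewrite ipC ipZl (ipC z). Qed.
Lemma ipNr x z : ip z (- x) = - ip z x.
Proof. by rewrite ipC ipNl (ipC z). Qed.
Lemma ipBr x y z : ip z (x - y) = ip z x - ip z y.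
Proof. by rewrite ipDr ipNr. Qed.
Lemma ip_suml I (r : seq I) (P : pred I) (F : I -> H) z :
  ip (\sum_(i <- r | P i) F i) z = \sum_(i <- r | P i) ip (F i) z.
Proof. by apply: (big_morph (fun x => ip x z)) => [x y|]; rewrite ?ipDl ?ip0l. Qed.
Lemma ip_sumr I (r : seq I) (P : pred I) (F : I -> H) z :
  ip z (\sum_(i <- r | P i) F i) = \sum_(i <- r | P i) ip z (F i).
Proof. by rewrite ipC ip_suml; apply: eq_bigr => i _; rewrite ipC. Qed.

Definition ipE := (ipDl, ipDr, ipBl, ipBr, ipZl, ipZr, ipNl, ipNr, ip0l, ip0r).

Lemma ip_ge0 x : 0 <= ip x x. Proof. exact: hilbert_ge0. Qed.
Lemma ip_eq0 x : ip x x = 0 -> x = 0. Proof. exact: hilbert_eq0. Qed.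

Lemma ip_ext x y : (forall z, ip x z = ip y z) -> x = y.
Proof.
by move=> h; apply/subr0_eq/ip_eq0; rewrite ipBl h subrr.
Qed.

Lemma hnorm_ge0 x : 0 <= 'nrm x. Proof. exact: sqrtr_ge0. Qed.
Lemma hnormE x : 'nrm x ^+ 2 = ip x x. Proof. by rewrite sqr_sqrtr ?ip_ge0. Qed.

Lemma cauchy_schwarz x y : `|ip x y| <= 'nrm x * 'nrm y.
Proof.
rewrite -ler_sqr ?nnegrE ?mulr_ge0 ?hnorm_ge0// real_normK ?num_real//.
rewrite exprMn !hnormE; apply: form_cauchy_schwarz => *; rewrite ?ipE//.
- exact: ipC.
- exact: ip_ge0.
Qed.

Lemma ler_ip x y : ip x y <= 'nrm x * 'nrm y.
Proof. exact: le_trans (ler_norm _) (cauchy_schwarz x y). Qed.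

Lemma hnormD x y : 'nrm (x + y) <= 'nrm x + 'nrm y.
Proof.
rewrite -ler_sqr ?nnegrE ?addr_ge0 ?hnorm_ge0// sqrrD !hnormE !ipE (ipC y x).
by have := ler_ip x y; lra.
Qed.

Lemma hnormZ a x : 'nrm (a *: x) = `|a| * 'nrm x.
Proof.
by rewrite /hnorm !ipE mulrA -expr2 sqrtrM ?sqr_ge0// sqrtr_sqr.
Qed.

Lemma hnormN x : 'nrm (- x) = 'nrm x.
Proof. by rewrite -scaleN1r hnormZ normrN1 mul1r. Qed.

Lemma hnorm0 : 'nrm 0 = 0. Proof. by rewrite /hnorm ip0l sqrtr0. Qed.

Lemma ler_hnorm x y : ip x x <= ip y y -> 'nrm x <= 'nrm y.
Proof. by move=> h; rewrite ler_sqrt// ip_ge0. Qed.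

Lemma ip_cvg_ip u v l m : ip_cvg ip u l -> ip_cvg ip v m ->
  ip (u n) (v n) @[n --> \oo] --> ip l m.
Proof.
move=> ul vm.
have small w k z : ip_cvg ip w k -> ip (w n - k) z @[n --> \oo] --> (0 : R).
  move=> wk; apply/norm_cvg0P.
  apply: (@squeeze_cvgr _ _ _ _ (fun=> 0) (fun n => 'nrm (w n - k) * 'nrm z)).
  - by apply: nearW => n; rewrite normr_ge0 cauchy_schwarz.
  - exact: cvg_cst.
  - by rewrite -(mul0r ('nrm z)); apply: cvgMr_tmp.
have small2 : ip (u n - l) (v n - m) @[n --> \oo] --> (0 : R).
  apply/norm_cvg0P.
  apply: (@squeeze_cvgr _ _ _ _ (fun=> 0)
    (fun n => 'nrm (u n - l) * 'nrm (v n - m))).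
  - by apply: nearW => n; rewrite normr_ge0 cauchy_schwarz.
  - exact: cvg_cst.
  - by rewrite -(mul0r 0); apply: cvgM.
have -> : (fun n => ip (u n) (v n)) = (fun n => ip (u n - l) (v n - m) +
    (ip (u n - l) m + (ip (v n - m) l + ip l m))).
  by apply/funext => n; rewrite !ipE (ipC (v n) l) (ipC m l); ring.
rewrite -[X in _ --> X]add0r -[X in 0 + X]add0r -[X in 0 + (0 + X)]add0r.
by do 2 (apply: cvgD; [exact: small2 || exact: small|]);
   apply: cvgD; [exact: small|exact: cvg_cst].
Qed.

Lemma ip_cvg_cst l : ip_cvg ip (fun=> l) l.
Proof. by rewrite /ip_cvg subrr hnorm0; exact: cvg_cst. Qed.

Lemma ip_cvg_weak u l z : ip_cvg ip u l -> ip (u n) z @[n --> \oo] --> ip l z.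
Proof. by move=> ul; apply: ip_cvg_ip => //; exact: ip_cvg_cst. Qed.

Arguments ip_cvg_weak [u l] z _.

(** The increments of a bounded monotone real sequence dominate the squared increments of [u]. This
    criterion serves both the square root iteration and Fourier series. *)
Lemma ip_cvg_mono u (r : nat -> R) (C : R) : (forall n, r n <= C) ->
  (forall n k, ip (u (n + k)%N - u n) (u (n + k)%N - u n) <= r (n + k)%N - r n) ->
  exists l, ip_cvg ip u l.
Proof.
move=> rC ur; apply: (hilbert_complete hH) => e e0.
have mono : {homo r : n m / (n <= m)%N >-> n <= m}.
  move=> n m nm; rewrite -subr_ge0 -(subnKC nm).
  by apply: le_trans (ur _ _); exact: ip_ge0.
have cr : cvgn r.
  by apply: nondecreasing_is_cvgn => //; exists C => _ [n _ <-].
have rL n : r n <= limn r := nondecreasing_cvgn_le mono cr n.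
have /cvgrPdist_lt/(_ (e ^+ 2))[|N _ HN] := cr; first exact: exprn_gt0.
have key k n : (N <= n)%N -> 'nrm (u (n + k)%N - u n) < e.
  move=> Nn; rewrite -ltr_sqr ?nnegrE ?hnorm_ge0 ?ltW// hnormE.
  apply: le_lt_trans (ur _ _) _; apply: le_lt_trans (HN n Nn).
  by apply: le_trans (ler_norm _); rewrite lerB.
exists N => m n Nm Nn; have [mn|nm] := leqP n m.
  by rewrite -(subnKC mn); exact: key.
by rewrite -hnormN opprB -(subnKC (ltnW nm)); exact: key.
Qed.

(** * Operators with an adjoint *)

Lemma adjC M N : is_adjoint ip M N -> is_adjoint ip N M.
Proof. by move=> h x y; rewrite ipC -h ipC. Qed.

Lemma adj_comp M M' N N' : is_adjoint ip M M' -> is_adjoint ip N N' ->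
  is_adjoint ip (M \o N) (N' \o M').
Proof. by move=> h k x y; rewrite /= h k. Qed.

(** Nondegeneracy of [ip] gives it, so operators are carried around with an adjoint in place of a
    linearity hypothesis. *)
Lemma adj_linear M N : is_adjoint ip M N -> linear_on setT M.
Proof. by move=> h a x y _ _; apply: ip_ext => z; rewrite h !ipE !h. Qed.

Section linear.
Context (M : H -> H) (lM : linear_on setT M).
Lemma linD x y : M (x + y) = M x + M y.
Proof. by have := lM 1 (x := x) (y := y) I I; rewrite !scale1r. Qed.
Lemma lin0 : M 0 = 0.
Proof. by apply: (addIr (M 0)); rewrite -linD !add0r. Qed.
Lemma linZ a x : M (a *: x) = a *: M x.
Proof. by have := lM a (x := x) (y := 0) I I; rewrite !addr0 lin0 addr0. Qed.
Lemma linB x y : M (x - y) = M x - M y.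
Proof. by rewrite -scaleN1r linD linZ scaleN1r. Qed.
Lemma lin_sum I (r : seq I) (P : pred I) (F : I -> H) :
  M (\sum_(i <- r | P i) F i) = \sum_(i <- r | P i) M (F i).
Proof. by apply: (big_morph M) => [x y|]; rewrite ?linD ?lin0. Qed.
End linear.

Lemma bounded_comp M N : bounded_op ip M -> bounded_op ip N ->
  bounded_op ip (M \o N).
Proof.
move=> [lM [c cM]] [lN [k kN]]; split.
  by move=> a x y _ _ /=; rewrite lN// lM.
exists (`|c| * `|k|) => x /=.
apply: (le_trans (cM _)); apply: (@le_trans _ _ (`|c| * 'nrm (N x))).
  by rewrite ler_wpM2r ?hnorm_ge0// ler_norm.
rewrite -mulrA ler_wpM2l//; apply: (le_trans (kN _)).
by rewrite ler_wpM2r ?hnorm_ge0// ler_norm.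
Qed.

Lemma psd_cauchy_schwarz S x y : psd_op ip S ->
  ip (S x) y ^+ 2 <= ip (S x) x * ip (S y) y.
Proof.
move=> [[lS _] aS pS]; apply: (@form_cauchy_schwarz _ _ (fun x y => ip (S x) y)).
- by move=> u v; rewrite aS ipC.
- by move=> a u v w; rewrite lS// !ipE.
- exact: pS.
Qed.

Lemma psd_ip0 S x : psd_op ip S -> ip (S x) x = 0 -> S x = 0.
Proof.
move=> hS h; apply: ip_eq0; apply/eqP; rewrite -sqrf_eq0 eq_le sqr_ge0 andbT.
by apply: le_trans (psd_cauchy_schwarz _ _ hS) _; rewrite h mul0r.
Qed.

(** * Square roots *)

Section sqrt_contraction.
Context (a : H -> H) (aa : is_adjoint ip a a).
Context (na : forall x, 'nrm (a x) <= 'nrm x).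

(* The iteration p <- (a + p ^ 2) / 2 converges to 1 - (1 - a)^(1/2). Its terms
   are polynomials in a whose increments have nonnegative coefficients, so for a
   contraction these are dominated in norm by those of the iteration at a = 1. *)
Fixpoint sq_iter n : H -> H :=
  if n is m.+1 then fun x => 2^-1 *: (a x + sq_iter m (sq_iter m x)) else fun=> 0.

Fixpoint sq_bound n : R :=
  if n is m.+1 then 2^-1 * (1 + sq_bound m ^+ 2) else 0.

Lemma sq_iter_adj n : is_adjoint ip (sq_iter n) (sq_iter n).
Proof.
elim: n => [|n IH] x y /=; first by rewrite !ipE.
by rewrite !ipE aa !IH.
Qed.

Lemma sq_iter_comm T n x : linear_on setT T -> (forall y, T (a y) = a (T y)) ->
  T (sq_iter n x) = sq_iter n (T x).
Proof.
move=> lT Ta; elim: n x => [|n IH] x /=; first by rewrite lin0.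
by rewrite linZ// linD// Ta !IH.
Qed.

Lemma sq_iter_commn m n x : sq_iter m (sq_iter n x) = sq_iter n (sq_iter m x).
Proof.
apply: sq_iter_comm => [|y]; first exact: adj_linear (sq_iter_adj m).
by rewrite -sq_iter_comm//; exact: adj_linear aa.
Qed.

Lemma sq_bound_ge0 n : 0 <= sq_bound n.
Proof. by case: n => //= n; have := sqr_ge0 (sq_bound n); lra. Qed.

Lemma sq_bound_le1 n : sq_bound n <= 1.
Proof.
elim: n => //= n IH; have := sq_bound_ge0 n => h.
have : sq_bound n ^+ 2 <= 1 by rewrite expr_le1.
by lra.
Qed.

Lemma sq_boundS n : sq_bound n <= sq_bound n.+1.
Proof.
by have := sqr_ge0 (sq_bound n - 1); rewrite /= sqrrB expr1n; lra.
Qed.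

Lemma sq_iter_le n x : 'nrm (sq_iter n x) <= sq_bound n * 'nrm x.
Proof.
elim: n x => [|n IH] x; first by rewrite hnorm0 mul0r.
rewrite /= hnormZ ger0_norm; last by lra.
rewrite -mulrA ler_wpM2l//.
apply: le_trans (hnormD _ _) _; rewrite mulrDl mul1r lerD//.
apply: le_trans (IH _) _; rewrite expr2 -mulrA ler_wpM2l ?sq_bound_ge0//.
Qed.

Lemma sq_iterS_le n x : 'nrm (sq_iter n.+1 x - sq_iter n x) <=
  (sq_bound n.+1 - sq_bound n) * 'nrm x.
Proof.
elim: n x => [|n IH] x.
  rewrite /= subr0 addr0 hnormZ ger0_norm; last by lra.
  by rewrite subr0 expr0n addr0 mulr1 ler_wpM2l//; lra.
set p := sq_iter n; set q := sq_iter n.+1.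
have lp : linear_on setT p by exact: adj_linear (sq_iter_adj n).
have lq : linear_on setT q by exact: adj_linear (sq_iter_adj n.+1).
(* As [p] and [q] commute, q^2 - p^2 = (q + p)(q - p); the scalar bounds factor likewise below. *)
have -> : sq_iter n.+2 x - q x =
    2^-1 *: (q (q x - p x) + p (q x - p x)).
  rewrite (linB lq) (linB lp) [q (p x)]sq_iter_commn -/p -/q.
  rewrite [q x in X in _ - X]/q [sq_iter n.+2 x]/= -/p -/q -scalerBr.
  by congr (_ *: _); rewrite opprD addrACA subrr add0r addrA subrK.
rewrite hnormZ ger0_norm; last by lra.
rewrite [sq_bound n.+2]/= [X in _ - X]/= -mulrBr -mulrA ler_wpM2l//.
apply: le_trans (hnormD _ _) _.
have -> : (1 + (2^-1 * (1 + sq_bound n ^+ 2)) ^+ 2 - (1 + sq_bound n ^+ 2)) * 'nrm x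
  = sq_bound n.+1 * ((sq_bound n.+1 - sq_bound n) * 'nrm x) +
    sq_bound n * ((sq_bound n.+1 - sq_bound n) * 'nrm x) by rewrite /=; ring.
by rewrite lerD//; apply: le_trans (sq_iter_le _ _) _;
  rewrite ler_wpM2l ?sq_bound_ge0//; exact: IH.
Qed.

Lemma sq_iterD_le n k x : 'nrm (sq_iter (n + k) x - sq_iter n x) <=
  (sq_bound (n + k) - sq_bound n) * 'nrm x.
Proof.
elim: k => [|k IH]; first by rewrite addn0 !subrr mul0r hnorm0.
rewrite addnS -(subrKA (sq_iter (n + k) x)).
apply: le_trans (hnormD _ _) _.
rewrite -[X in _ <= X * _](subrKA (sq_bound (n + k))) mulrDl lerD//.
exact: sq_iterS_le.
Qed.

Lemma sq_iter_cvg x : exists l, ip_cvg ip (sq_iter ^~ x) l.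
Proof.
apply: (@ip_cvg_mono _ (fun n => sq_bound n * ip x x) (ip x x)) => n.
  by rewrite ler_piMl ?ip_ge0 ?sq_bound_le1.
move=> k; rewrite -hnormE -mulrBl -hnormE.
set b := sq_bound (n + k) - sq_bound n.
have h : 'nrm (sq_iter (n + k) x - sq_iter n x) <= b * 'nrm x := sq_iterD_le n k x.
have b0 : 0 <= b.
  have /nondecreasing_seqP mono : forall m, sq_bound m <= sq_bound m.+1 := sq_boundS.
  by rewrite subr_ge0 mono// leq_addr.
have b1 : b <= 1.
  by have := sq_bound_le1 (n + k); have := sq_bound_ge0 n; rewrite /b; lra.
(* Squared norms have to lie under linear increments: b^2 <= b since b is in [0, 1]. *)
apply: (@le_trans _ _ ((b * 'nrm x) ^+ 2)).
  by rewrite ler_sqr ?nnegrE ?mulr_ge0 ?hnorm_ge0.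
by rewrite exprMn ler_wpM2r ?sqr_ge0// expr2 ler_piMl.
Qed.

Lemma sqrt_contraction : exists S, [/\ is_adjoint ip S S,
  forall x, S (S x) = x - a x, forall x, 0 <= ip (S x) x &
  forall T x, is_adjoint ip T T -> (forall y, T (a y) = a (T y)) ->
    T (S x) = S (T x)].
Proof.
have [y Hy] := boolp.choice sq_iter_cvg.
have ya : is_adjoint ip y y.
  move=> x z; apply: (cvgR_unique (ip_cvg_weak z (Hy x))).
  under eq_fun do rewrite sq_iter_adj ipC.
  by rewrite (ipC x); exact: ip_cvg_weak.
have yle x : ip (y x) (y x) <= ip x x.
  apply: (cvgR_le (ip_cvg_ip (Hy x) (Hy x)) (cvg_cst (ip x x))) => n.
  rewrite -!hnormE ler_sqr ?nnegrE ?hnorm_ge0//.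
  apply: le_trans (sq_iter_le _ _) _.
  by rewrite ler_piMl ?hnorm_ge0 ?sq_bound_le1.
(* The recursion in the limit, 2y = a + y^2, so that (1 - y)^2 = 1 - a. Testing the square as
   [ip (y x) (y z)] makes convergence at fixed vectors sufficient. *)
have y2 x : y (y x) = 2 *: y x - a x.
  apply: ip_ext => z; rewrite ya.
  have h1 := ip_cvg_ip (Hy x) (Hy z).
  have h2 := ip_cvg_weak z (Hy x).
  have h3 : ip (sq_iter n.+1 x) z @[n --> \oo] --> ip (y x) z.
    by rewrite (cvg_shiftS (fun n => ip (sq_iter n x) z)).
  apply: (cvgR_unique h1).
  rewrite !ipE; have -> : (fun n => ip (sq_iter n x) (sq_iter n z)) =
    (fun n => 2 * ip (sq_iter n.+1 x) z - ip (a x) z).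
    by apply/funext => n; rewrite /= !ipE (sq_iter_adj n (sq_iter n x)); field.
  by apply: cvgB; [apply: cvgMl_tmp|exact: cvg_cst].
have ly : linear_on setT y := adj_linear ya.
exists (fun x => x - y x); split.
- by move=> x z; rewrite !ipE ya.
- move=> x; rewrite (linB ly) y2 scaler_nat mulr2n !opprB.
  by rewrite [X in _ + X]addrAC addrK addrA subrK.
- move=> x; rewrite !ipE subr_ge0.
  apply: le_trans (ler_ip _ _) _; rewrite -hnormE expr2 ler_wpM2r ?hnorm_ge0//.
  exact: ler_hnorm.
- move=> T x Ta Tc; have lT := adj_linear Ta.
  rewrite (linB lT); congr (_ - _).
  apply: ip_ext => z; rewrite Ta.
  apply: (cvgR_unique (ip_cvg_weak _ (Hy x))).
  under eq_fun do rewrite -Ta sq_iter_comm//.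
  exact: ip_cvg_weak.
Qed.
End sqrt_contraction.

(** |S x|^2 = <M x, x> bounds [S]; the constant |c| + 1 works because its square dominates |c|. *)
Lemma sym_sqrt_psd M S : bounded_op ip M -> is_adjoint ip S S ->
  (forall x, 0 <= ip (S x) x) -> S \o S = M -> psd_op ip S.
Proof.
move=> [_ [c cM]] aS pS SM; split => //; split; first exact: adj_linear aS.
exists (`|c| + 1) => x.
have k0 : 0 <= `|c| + 1 by rewrite addr_ge0.
rewrite -ler_sqr ?nnegrE ?mulr_ge0 ?hnorm_ge0// hnormE -aS.
have -> : S (S x) = M x by rewrite -SM.
apply: le_trans (ler_ip _ _) _; rewrite exprMn [X in _ <= _ * X]expr2 mulrA.
rewrite ler_wpM2r ?hnorm_ge0//; apply: le_trans (cM x) _.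
rewrite ler_wpM2r ?hnorm_ge0//; apply: le_trans (ler_norm c) _.
by have := normr_ge0 c; nra.
Qed.

Lemma psd_sqrt_exists M : psd_op ip M -> exists S,
  [/\ psd_op ip S, S \o S = M & forall T x, is_adjoint ip T T ->
    (forall y, T (M y) = M (T y)) -> T (S x) = S (T x)].
Proof.
move=> [bM aM pM]; have [lM [c cM]] := bM.
(* A positive bound of [M]: the form of a = 1 - M/k then lies between 0 and that of the identity, so
   [a] is a contraction and the root of 1 - a is that of M/k. *)
pose k := `|c| + 1.
have k0 : 0 < k by rewrite ltr_wpDl.
pose a x := x - k^-1 *: M x.
have aa : is_adjoint ip a a by move=> x y; rewrite /a !ipE aM.
have ale x : ip (a x) x <= ip x x.
  by rewrite /a !ipE gerBl mulr_ge0// invr_ge0 ltW.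
have ale' x : 0 <= ip (a x) x.
  rewrite /a !ipE subr_ge0 mulrC ler_pdivrMr//.
  apply: le_trans (ler_ip _ _) _; rewrite -hnormE expr2 mulrC -mulrA.
  rewrite ler_wpM2l ?hnorm_ge0//; apply: le_trans (cM x) _.
  rewrite mulrC ler_wpM2l ?hnorm_ge0//; apply: le_trans (ler_norm c) _.
  by rewrite lerDl.
have na x : 'nrm (a x) <= 'nrm x.
  apply: ler_hnorm.
  have [->|ax0] := eqVneq (ip (a x) (a x)) 0; first exact: ip_ge0.
  have axp : 0 < ip (a x) (a x) by rewrite lt_def ax0 ip_ge0.
  rewrite -(ler_pM2r axp) -expr2.
  (* For the form of [a]: |a x|^4 <= <a x, x> <a a x, a x> <= |x|^2 |a x|^2. *)
  have := @form_cauchy_schwarz _ _ (fun x y => ip (a x) y) _ _ ale' x (a x).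
  move=> /(_ _ _)/le_trans; apply.
  - by move=> u v; rewrite aa ipC.
  - by move=> b u v w; rewrite (adj_linear aa)// !ipE.
  - by rewrite ler_pM.
have [S [aS SS pS cS]] := sqrt_contraction aa na.
pose Q x := Num.sqrt k *: S x.
have aQ : is_adjoint ip Q Q by move=> x y; rewrite /Q !ipE aS.
have QQ : Q \o Q = M.
  apply/funext => x; rewrite /Q /= (linZ (adj_linear aS)) scalerA -expr2.
  by rewrite sqr_sqrtr ?ltW// SS /a subKr scalerA mulfV ?gt_eqF// scale1r.
exists Q; split => //.
  by apply: (sym_sqrt_psd bM) => // x; rewrite /Q !ipE mulr_ge0 ?sqrtr_ge0.
move=> T x aT TM; have lT := adj_linear aT.
rewrite /Q (linZ lT) cS// => y.
by rewrite /a (linB lT) (linZ lT) TM.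
Qed.

(** Two given roots are not known to commute, so each is compared with the constructed root [S0],
    which commutes with every symmetric operator commuting with the square. Then (P + S0)(P - S0) =
    0, and positivity makes both terms of this sum vanish. *)
Lemma psd_sqrt_unique S S' : psd_op ip S -> psd_op ip S' -> S \o S = S' \o S' ->
  S = S'.
Proof.
move=> hS hS' E; have [bS aS pS] := hS; have [bS' aS' pS'] := hS'.
have hM : psd_op ip (S \o S).
  split; [exact: bounded_comp|exact: adj_comp|].
  by move=> x /=; rewrite aS ip_ge0.
have [S0 [hS0 E0 cS0]] := psd_sqrt_exists hM.
have [_ aS0 pS0] := hS0.
suff key P : psd_op ip P -> P \o P = S \o S -> P = S0.
  by rewrite (key _ hS erefl) (key _ hS' (esym E)).
move=> hP PE; have [_ aP pP] := hP; have lP := adj_linear aP.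
have lS0 := adj_linear aS0.
have comm x : P (S0 x) = S0 (P x).
  by apply: cS0 => // y; rewrite -PE.
have P0 y : P (P y) = S0 (S0 y).
  by have : (P \o P) y = (S0 \o S0) y by rewrite PE E0.
apply/funext => x; apply/subr0_eq; set y := P x - S0 x.
have sum0 : P y + S0 y = 0.
  by rewrite /y (linB lP) (linB lS0) comm P0 addrA subrK subrr.
have [Py S0y] : ip (P y) y = 0 /\ ip (S0 y) y = 0.
  have : ip (P y) y + ip (S0 y) y = 0 by rewrite -ipDl sum0 ip0l.
  by have := pP y; have := pS0 y; lra.
have Py0 := psd_ip0 hP Py; have S0y0 := psd_ip0 hS0 S0y.
by apply: ip_eq0; rewrite {1}/y ipBl aP aS0 Py0 S0y0 subrr.
Qed.

Lemma sqrt_opE M S : psd_op ip S -> S \o S = M -> sqrt_op ip M = S.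
Proof.
move=> hS E; rewrite /sqrt_op; case: xgetP => [Q _ [hQ QM]|/(_ S)]; last first.
  by move/not_andP => [].
by apply: psd_sqrt_unique; rewrite // QM.
Qed.

Lemma sqrt_op_psd M : psd_op ip M ->
  psd_op ip (sqrt_op ip M) /\ sqrt_op ip M \o sqrt_op ip M = M.
Proof.
by move=> /psd_sqrt_exists[S [hS SM _]]; rewrite (sqrt_opE hS SM).
Qed.

(** * Orthonormal systems *)

(** Unlike [onb], not total: the vectors [P \o c] only span part of the space. Zero vectors keep the
    index set [nat] when Gram-Schmidt meets a dependent vector. *)
Definition orthosys (e : nat -> H) : Prop :=
  (forall i, e i = 0 \/ ip (e i) (e i) = 1) /\
  (forall i j, i != j -> ip (e i) (e j) = 0).

Section orthosys.
Context (e : nat -> H) (oe : orthosys e).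

Lemma orthosys_scale a i : (a * ip (e i) (e i)) *: e i = a *: e i.
Proof. by case: (oe.1 i) => ->; rewrite ?scaler0 ?mulr1. Qed.

Lemma orthosys_ip x i : ip x (e i) * ip (e i) (e i) = ip x (e i).
Proof. by case: (oe.1 i) => ->; rewrite ?mulr1// !ip0r mulr0. Qed.

Lemma orthosys_suml (a : nat -> R) n j : (j < n)%N ->
  ip (\sum_(i < n) a i *: e i) (e j) = a j * ip (e j) (e j).
Proof.
move=> jn; rewrite ip_suml (bigD1 (Ordinal jn))//= big1 ?addr0 ?ipZl// => i ij.
by rewrite ipZl oe.2 ?mulr0.
Qed.

Lemma orthosys_suml0 (a : nat -> R) n j : (n <= j)%N ->
  ip (\sum_(i < n) a i *: e i) (e j) = 0.
Proof.
move=> nj; rewrite ip_suml big1// => i _.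
by rewrite ipZl oe.2 ?mulr0// ltn_eqF// (leq_trans (ltn_ord i) nj).
Qed.

Lemma orthosys_sum_sqr (a : nat -> R) n :
  ip (\sum_(i < n) a i *: e i) (\sum_(i < n) a i *: e i) =
  \sum_(i < n) a i ^+ 2 * ip (e i) (e i).
Proof.
rewrite ip_sumr; apply: eq_bigr => i _.
by rewrite ipZr orthosys_suml// mulrA -expr2.
Qed.

Lemma bessel x n : \sum_(i < n) ip x (e i) ^+ 2 <= ip x x.
Proof.
have := ip_ge0 (x - \sum_(i < n) ip x (e i) *: e i).
rewrite ipBr 2!ipBl (orthosys_sum_sqr (fun i => ip x (e i))).
rewrite (ipC (\sum_(i < n) _) x) ip_sumr.
have -> : \sum_(i < n) ip x (e i) ^+ 2 * ip (e i) (e i) =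
    \sum_(i < n) ip x (e i) ^+ 2.
  by apply: eq_bigr => i _; rewrite expr2 -mulrA orthosys_ip.
have -> : \sum_(i < n) ip x (ip x (e i) *: e i) = \sum_(i < n) ip x (e i) ^+ 2.
  by apply: eq_bigr => i _; rewrite ipZr.
by rewrite subrr subr0 subr_ge0.
Qed.

Lemma fourier_cvg (a : nat -> R) (C : R) : (forall n, \sum_(i < n) a i ^+ 2 <= C) ->
  exists l, ip_cvg ip (fun n => \sum_(i < n) a i *: e i) l.
Proof.
move=> aC; apply: (@ip_cvg_mono _ (fun n => \sum_(i < n) a i ^+ 2) C) => // n k.
elim: k => [|k IH]; first by rewrite addn0 !subrr ip0l.
rewrite addnS !big_ord_recr/= addrAC [X in _ <= X]addrAC.
set w := _ - _ in IH *.
have w0 : ip w (e (n + k)%N) = 0 by rewrite ipBl !orthosys_suml0 ?subrr ?leq_addr.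
clearbody w; rewrite !ipE (ipC (e _)) w0 !mulr0 addr0 add0r lerD// mulrA -expr2.
by case: (oe.1 (n + k)%N) => ->; rewrite ?mulr1// ip0l mulr0 sqr_ge0.
Qed.

End orthosys.

Section gram_schmidt.
Context (P : H -> H) (lP : linear_on setT P) (d : nat -> H).

Let gs_next (l : seq H) (x : H) : H :=
  let g := x - \sum_(v <- l) ip (P x) (P v) *: v in ('nrm (P g))^-1 *: g.

(** Each vector needs all its predecessors, so the recursion builds their list. *)
Let gs := fix gs n := if n is m.+1 then rcons (gs m) (gs_next (gs m) (d m)) else [::].

Let c n := gs_next (gs n) (d n).

Let gsE n : gs n = mkseq c n.
Proof. by elim: n => // n IH; rewrite mkseqS -IH. Qed.

Let g n := d n - \sum_(i < n) ip (P (d n)) (P (c i)) *: c i.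

Let cE n : c n = ('nrm (P (g n)))^-1 *: g n.
Proof.
rewrite {1}/c /gs_next gsE.
suff -> : \sum_(v <- mkseq c n) ip (P (d n)) (P v) *: v =
  \sum_(i < n) ip (P (d n)) (P (c i)) *: c i by [].
by rewrite big_map -(big_mkord xpredT (fun i => ip (P (d n)) (P (c i)) *: c i))
  /index_iota subn0.
Qed.

(* The [c n] depend on [P] only through the form [ip (P x) (P y)]: any [Q] with
   the same form maps them to an orthonormal system too. *)
Lemma gram_schmidt : exists c, orthosys (P \o c) /\
  forall n, P (d n) = \sum_(i < n.+1) ip (P (d n)) (P (c i)) *: P (c i).
Proof.
exists c.
have Pc n : P (c n) = ('nrm (P (g n)))^-1 *: P (g n) by rewrite cE (linZ lP).
have Pg n : P (g n) = P (d n) - \sum_(i < n) ip (P (d n)) (P (c i)) *: P (c i).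
  rewrite (linB lP) (lin_sum lP); congr (_ - _).
  by apply: eq_bigr => i _; rewrite (linZ lP).
have unit n : P (c n) = 0 \/ ip (P (c n)) (P (c n)) = 1.
  (* A dependent vector yields zero, through the convention 0^-1 = 0. *)
  rewrite Pc; have [->|h0] := eqVneq ('nrm (P (g n))) 0.
    by left; rewrite invr0 scale0r.
  by right; rewrite !ipE -hnormE; field.
have orth n j : (j < n)%N -> ip (P (c n)) (P (c j)) = 0.
  elim/ltn_ind: n j => n IH j jn; rewrite Pc ipZl.
  suff -> : ip (P (g n)) (P (c j)) = 0 by rewrite mulr0.
  rewrite Pg ipBl ip_suml.
  rewrite (bigD1 (Ordinal jn))//= big1 ?addr0 => [|i ij]; last first.
    rewrite ipZl; have [ij'|ji|E] := ltngtP i j;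
      last by rewrite -(inj_eq val_inj) /= E eqxx in ij.
    - by rewrite (ipC (P (c i))) IH ?mulr0.
    - by rewrite IH ?mulr0.
  rewrite ipZl; case: (unit j) => ->; first by rewrite !ip0r mul0r subrr.
  by rewrite mulr1 subrr.
have oPc : orthosys (P \o c).
  split => // i j; rewrite neq_ltn => /orP[ij|ji] /=; last exact: orth.
  by rewrite ipC orth.
split => // n.
have E : P (d n) = P (g n) + \sum_(i < n) ip (P (d n)) (P (c i)) *: P (c i).
  by rewrite Pg subrK.
have Pgn : P (g n) = 'nrm (P (g n)) *: P (c n).
  rewrite Pc scalerA; have [h0|h0] := eqVneq ('nrm (P (g n))) 0.
    by rewrite h0 mul0r scale0r; apply: ip_eq0; rewrite -hnormE h0 expr0n.
  by rewrite mulfV// scale1r.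
rewrite big_ord_recr/= [LHS]E addrC; congr (_ + _).
rewrite {1}E ipDl (orthosys_suml0 oPc (fun i => ip (P (d n)) (P (c i))))// addr0.
by rewrite {2}Pgn ipZl (orthosys_scale oPc) -Pgn.
Qed.

End gram_schmidt.

(** * Separability, bases and partial isometries *)

Definition dense_seq (d : nat -> H) : Prop :=
  forall (x : H) (e : R), 0 < e -> exists n, 'nrm (x - d n) < e.

Lemma separable_dense_seq : separable_space ip -> exists d, dense_seq d.
Proof.
move=> [D /countable_injP[f finj] hD].
(* Indices that code no point of [D] get 0, possibly outside [D]; density survives added points. *)
exists (fun n => xget 0 [set y | D y /\ f y = n]) => x e e0.
have [y Dy xy] := hD x e e0; exists (f y).
case: xgetP => [z E [Dz fz]|/(_ y)]; last by move/not_andP => [].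
by have -> : z = y by apply: finj; rewrite ?inE.
Qed.

(** Approximate [x] within its own norm: |x|^2 = <x, x - d n> <= |x| |x - d n| < |x|^2. *)
Lemma dense_eq0 d x : dense_seq d -> (forall n, ip x (d n) = 0) -> x = 0.
Proof.
move=> dd xd; apply: ip_eq0; rewrite -hnormE; apply/eqP; rewrite sqrf_eq0.
rewrite eq_le hnorm_ge0 andbT leNgt; apply/negP => x0.
have [n] := dd x _ x0; apply/negP; rewrite -leNgt.
rewrite -(ler_pM2l x0) -expr2 hnormE.
by apply: le_trans (ler_ip _ _); rewrite ipBr xd subr0.
Qed.

Section separable.
Context (d : nat -> H) (dd : dense_seq d).

Lemma onb_exists : exists e, onb ip e.
Proof.
have [//|c [[c1 c2] cd]] := @gram_schmidt idfun _ d; exists c; split => // x xc.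
apply: (dense_eq0 dd) => n; have {1}-> : d n = idfun (d n) by [].
by rewrite cd ip_sumr big1// => i _; rewrite ipZr xc mulr0.
Qed.

(* If P^*P = Q^*Q, the partial isometry from the closure of the range of [P] to
   that of [Q]. *)
Lemma polar P Q P' Q' : is_adjoint ip P P' -> is_adjoint ip Q Q' ->
  (forall x, ip (P x) (P x) = ip (Q x) (Q x)) ->
  exists U V, [/\ is_adjoint ip U V, bounded_op ip U, bounded_op ip V,
    forall x, U (P x) = Q x & forall x, V (Q x) = P x].
Proof.
move=> aP aQ PQ; have lP := adj_linear aP; have lQ := adj_linear aQ.
have PQ2 x y : ip (P x) (P y) = ip (Q x) (Q y).
  have := PQ (x + y); rewrite (linD lP) (linD lQ) !ipE (ipC (P y)) (ipC (Q y)).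
  by have := PQ x; have := PQ y; lra.
have [c [oP Pd]] := gram_schmidt lP d.
have oQ : orthosys (Q \o c).
  split=> [i|i j ij] /=; last by rewrite -PQ2 oP.2.
  rewrite -PQ2; case: (oP.1 i) => /= h; last by right.
  by left; apply: ip_eq0; rewrite -PQ2 h ip0l.
have Qd n : Q (d n) = \sum_(i < n.+1) ip (Q (d n)) (Q (c i)) *: Q (c i).
  apply/subr0_eq/ip_eq0.
  (* Both expansions have the same coefficients, so the remainder for [Q] is the image of one vector
     [w], and |Q w| = |P w| = 0. *)
  pose w := d n - \sum_(i < n.+1) ip (P (d n)) (P (c i)) *: c i.
  have Qw : Q w = Q (d n) - \sum_(i < n.+1) ip (Q (d n)) (Q (c i)) *: Q (c i).
    by rewrite (linB lQ) (lin_sum lQ); congr (_ - _); apply: eq_bigr => i _;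
      rewrite (linZ lQ) PQ2.
  rewrite -Qw -PQ; have -> : P w = 0; last by rewrite ip0l.
  rewrite (linB lP) (lin_sum lP) {1}Pd; apply/eqP; rewrite subr_eq0; apply/eqP.
  by apply: eq_bigr => i _; rewrite (linZ lP).
have FC (e f : nat -> H) (x : H) : orthosys e -> orthosys f ->
    exists l, ip_cvg ip (fun n => \sum_(i < n) ip x (e i) *: f i) l.
  move=> oe of_; apply: (@fourier_cvg f of_ (fun i => ip x (e i)) (ip x x)) => n.
  exact: bessel.
(* U x is the sum of the <x, P c_i> Q c_i; V x is the same with P and Q exchanged. *)
have [U HU] := boolp.choice (fun x => FC _ _ x oP oQ).
have [V HV] := boolp.choice (fun x => FC _ _ x oQ oP).
have contr (e f : nat -> H) W : orthosys e -> orthosys f ->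
    (forall x, ip_cvg ip (fun n => \sum_(i < n) ip x (e i) *: f i) (W x)) ->
    forall x, 'nrm (W x) <= 1 * 'nrm x.
  move=> oe of_ HW x; rewrite mul1r; apply: ler_hnorm.
  apply: (cvgR_le (ip_cvg_ip (HW x) (HW x)) (cvg_cst (ip x x))) => n.
  rewrite (orthosys_sum_sqr of_ (fun i => ip x (e i))).
  apply: le_trans (bessel oe x n); apply: ler_sum => i _.
  by case: (of_.1 i) => ->; rewrite ?mulr1// ip0l mulr0 sqr_ge0.
have UV : is_adjoint ip U V.
  move=> x z; apply: (cvgR_unique (ip_cvg_weak z (HU x))).
  rewrite ipC; have := ip_cvg_weak x (HV z); apply: cvg_trans; apply: near_eq_cvg.
  apply: nearW => n; rewrite !ip_suml; apply: eq_bigr => i _.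
  by rewrite !ipZl /= (ipC (Q _)) (ipC (P _)) mulrC.
have VU := adjC UV.
(* Equality on the dense sequence is moved to the adjoints: (W' - N') z is orthogonal to every
   [d n], hence zero. *)
have dW (W W' N N' : H -> H) : is_adjoint ip W W' -> is_adjoint ip N N' ->
    (forall n, W (d n) = N (d n)) -> forall x, W x = N x.
  move=> aW aN WN x; apply: ip_ext => z; rewrite aW aN; apply/eqP.
  rewrite -subr_eq0 -ipBr ipC; apply/eqP; rewrite (_ : _ - _ = 0) ?ip0l//.
  by apply: (dense_eq0 dd) => n; rewrite ipC ipBr -aW -aN WN subrr.
(* On a finite combination of the system the defining series is eventually constant. *)
have stat (e f : nat -> H) W y n : orthosys e -> orthosys f ->
    (forall x, ip_cvg ip (fun n => \sum_(i < n) ip x (e i) *: f i) (W x)) ->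
    y = \sum_(i < n) ip y (e i) *: e i -> W y = \sum_(i < n) ip y (e i) *: f i.
  move=> oe of_ HW yE; apply: ip_ext => z.
  apply: (cvgR_unique (ip_cvg_weak z (HW y))).
  apply: cvg_near_cst; exists n => // m /= nm; congr (ip _ z).
  rewrite -(subnKC nm) big_split_ord/= [X in _ + X]big1 ?addr0// => i _.
  by rewrite yE (orthosys_suml0 oe (fun i => ip y (e i))) ?scale0r ?leq_addr.
exists U, V; split => //.
- by split; [exact: adj_linear UV|exists 1; exact: contr HU].
- by split; [exact: adj_linear VU|exists 1; exact: contr HV].
- apply: (dW (U \o P) (P' \o V) Q Q') => // [|n /=]; first exact: adj_comp.
  rewrite (stat _ _ _ _ n.+1 oP oQ HU)//; rewrite [RHS]Qd.
  by apply: eq_bigr => i _ /=; rewrite PQ2.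
- apply: (dW (V \o Q) (Q' \o U) P P') => // [|n /=]; first exact: adj_comp.
  rewrite (stat _ _ _ _ n.+1 oQ oP HV)//; rewrite [RHS]Pd.
  by apply: eq_bigr => i _ /=; rewrite PQ2.
Qed.

(** * Hilbert-Schmidt operators *)

Lemma parseval e x : onb ip e ->
  \sum_(i < n) ip x (e i) ^+ 2 @[n --> \oo] --> ip x x.
Proof.
move=> [e1 e2 e3]; have oe : orthosys e by [].
have [l Hl] := @fourier_cvg e oe (fun i => ip x (e i)) (ip x x) (bessel oe x).
have <- : l = x.
  apply/subr0_eq/e3 => j; rewrite ipBl; apply/eqP; rewrite subr_eq0; apply/eqP.
  apply: (cvgR_unique (ip_cvg_weak (e j) Hl)).
  apply: cvg_near_cst; exists j.+1 => // m /= jm.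
  by rewrite (orthosys_suml oe (fun i => ip x (e i)))// orthosys_ip.
have := ip_cvg_ip Hl Hl; apply: cvg_trans; apply: near_eq_cvg; apply: nearW => n.
rewrite (orthosys_sum_sqr oe (fun i => ip x (e i))); apply: eq_bigr => i _.
have -> : ip l (e i) = ip x (e i).
  apply: (cvgR_unique (ip_cvg_weak (e i) Hl)).
  apply: cvg_near_cst; exists i.+1 => // m /= jm.
  by rewrite (orthosys_suml oe (fun i => ip x (e i)))// orthosys_ip.
by rewrite expr2 -mulrA orthosys_ip.
Qed.

Definition hs_sum (A : H -> H) (e : nat -> H) (n : nat) : R :=
  \sum_(i < n) ip (A (e i)) (A (e i)).

(** One bound for all orthonormal systems: a system with a single unit vector then yields
    boundedness, and for kernels the bound comes straight from Bessel's inequality. *)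
Definition hilbert_schmidt (A : H -> H) : Prop :=
  exists c, forall e, orthosys e -> forall n, hs_sum A e n <= c.

(** Sum <B f_i, e_j>^2 = <f_i, A e_j>^2 over both indices: Parseval in j, exchange, then Bessel in
    i. *)
Lemma hs_sum_adj A B e f c : is_adjoint ip A B -> onb ip e -> orthosys f ->
  (forall n, hs_sum A e n <= c) -> forall n, hs_sum B f n <= c.
Proof.
move=> aA oe of_ Ac n.
have h : \sum_(i < n) \sum_(j < m) ip (B (f i)) (e j) ^+ 2 @[m --> \oo] -->
    hs_sum B f n.
  rewrite /hs_sum; elim: n => [|n IH].
    under eq_fun do rewrite big_ord0.
    by rewrite big_ord0; exact: cvg_cst.
  under eq_fun do rewrite big_ord_recr/=.
  by rewrite big_ord_recr/=; apply: cvgD => //; exact: parseval.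
apply: (cvgR_le h (cvg_cst c)) => m; apply: le_trans (Ac m).
rewrite exchange_big/=; apply: ler_sum => j _.
apply: le_trans (bessel of_ _ n); apply: ler_sum => i _.
by rewrite (adjC aA) ipC.
Qed.

Lemma onb_orthosys e : onb ip e -> orthosys e. Proof. by case. Qed.

Lemma hs_adj A B : is_adjoint ip A B -> hilbert_schmidt A -> hilbert_schmidt B.
Proof.
move=> aA [c Ac]; have [e oe] := onb_exists; exists c => f of_.
by apply: (hs_sum_adj aA oe of_) => n; apply: Ac; exact: onb_orthosys.
Qed.

Lemma hs_compl A V : hilbert_schmidt A -> bounded_op ip V ->
  hilbert_schmidt (V \o A).
Proof.
move=> [c Ac] [_ [k kV]]; exists (k ^+ 2 * c) => e oe n.
apply: (@le_trans _ _ (k ^+ 2 * hs_sum A e n)); last first.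
  by rewrite ler_wpM2l ?sqr_ge0// Ac.
rewrite mulr_sumr; apply: ler_sum => i _ /=.
rewrite -!hnormE -exprMn ler_sqr ?nnegrE ?hnorm_ge0//.
exact: le_trans (hnorm_ge0 _) (kV _).
Qed.

(** [A \o V] is the adjoint of [V' \o B], which reduces the claim to composition on the left. *)
Lemma hs_compr A B V V' : is_adjoint ip A B -> is_adjoint ip V V' ->
  bounded_op ip V' -> hilbert_schmidt A -> hilbert_schmidt (A \o V).
Proof.
move=> aA aV bV hA; apply: (hs_adj (adjC (adj_comp aA aV))).
by apply: hs_compl => //; exact: hs_adj hA.
Qed.

Lemma hs_bounded A B : is_adjoint ip A B -> hilbert_schmidt A -> bounded_op ip A.
Proof.
move=> aA [c Ac]; split; first exact: adj_linear aA.
exists (Num.sqrt c) => x; have [x0|x0] := eqVneq ('nrm x) 0.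
  have -> : x = 0 by apply: ip_eq0; rewrite -hnormE x0 expr0n.
  by rewrite (lin0 (adj_linear aA)) hnorm0 mulr0.
have xx : ip x x != 0 by rewrite -hnormE sqrf_eq0.
(* The normalized [x] padded with zeros, so that one term of the sum bounds |A x|. *)
pose e (i : nat) := if i == 0%N then ('nrm x)^-1 *: x else 0.
have oe : orthosys e.
  split=> [[|i]|[|i] [|j]] //; rewrite /e/= ?ip0l ?ip0r//; last by left.
  by right; rewrite !ipE -hnormE; field.
have := Ac e oe 1%N; rewrite /hs_sum big_ord_recl big_ord0 addr0 /e/=.
rewrite (linZ (adj_linear aA)) !ipE -hnormE => h.
have c0 : 0 <= c by apply: le_trans h; rewrite !mulr_ge0 ?invr_ge0 ?hnorm_ge0 ?sqr_ge0.
rewrite -ler_sqr ?nnegrE ?mulr_ge0 ?sqrtr_ge0 ?hnorm_ge0// exprMn (sqr_sqrtr c0).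
have xp : 0 < 'nrm x ^+ 2 by rewrite exprn_gt0// lt_def x0 hnorm_ge0.
rewrite -ler_pdivrMr//; apply: le_trans h; rewrite le_eqVlt; apply/orP; left.
by apply/eqP; field.
Qed.

Lemma hs_lin A A' B B' a : is_adjoint ip A A' -> is_adjoint ip B B' ->
  hilbert_schmidt A -> hilbert_schmidt B ->
  is_adjoint ip (fun x => A x + a *: B x) (fun x => A' x + a *: B' x) /\
  hilbert_schmidt (fun x => A x + a *: B x).
Proof.
move=> aA aB [c Ac] [k kB]; split; first by move=> x y; rewrite !ipE aA aB.
exists (2 * c + 2 * a ^+ 2 * k) => e oe n.
apply: (@le_trans _ _ (2 * hs_sum A e n + 2 * a ^+ 2 * hs_sum B e n)); last first.
  by rewrite lerD// ler_wpM2l ?Ac ?kB// mulr_ge0 ?sqr_ge0.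
rewrite /hs_sum !mulr_sumr -big_split/=; apply: ler_sum => i _.
(* |u + v|^2 <= 2|u|^2 + 2|v|^2 amounts to |u - v|^2 >= 0. *)
have := ip_ge0 (A (e i) - a *: B (e i)).
by rewrite !ipE (ipC (B _)); lra.
Qed.

Lemma hs_sum_mono A e : {homo hs_sum A e : n m / (n <= m)%N >-> n <= m}.
Proof.
by apply/nondecreasing_seqP => n; rewrite /hs_sum big_ord_recr/= lerDl ip_ge0.
Qed.

(** The limit for [B] is at most that for [A]; going back through the adjoint gives the converse,
    whatever the two bases. *)
Lemma hs_sum_adj_cvg A B e f (t : R) : is_adjoint ip A B -> onb ip e -> onb ip f ->
  hs_sum A e n @[n --> \oo] --> t -> hs_sum B f n @[n --> \oo] --> t.
Proof.
move=> aA oe of_ At.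
have le1 C D g h (s : R) : is_adjoint ip C D -> onb ip g -> onb ip h ->
    hs_sum C g n @[n --> \oo] --> s ->
    exists2 s', s' <= s & hs_sum D h n @[n --> \oo] --> s'.
  move=> aC og oh Cs.
  have Cn n : hs_sum C g n <= s.
    have := nondecreasing_cvgn_le (@hs_sum_mono C g) (cvgP _ Cs) n.
    by rewrite (cvg_lim _ Cs).
  have Dn := hs_sum_adj aC og (onb_orthosys oh) Cn.
  have cD : cvgn (hs_sum D h).
    apply: nondecreasing_is_cvgn; first exact: hs_sum_mono.
    by exists s => _ [n _ <-].
  exists (limn (hs_sum D h)) => //.
  exact: (cvgR_le cD (cvg_cst s)).
have [s st Bs] := le1 _ _ _ _ _ aA oe of_ At.
have [t' ts At'] := le1 _ _ _ _ _ (adjC aA) of_ oe Bs.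
have tt' := cvgR_unique At At'.
have -> : t = s by apply/le_anti; rewrite st tt' ts.
exact: Bs.
Qed.

Lemma hs_sum_cvg A B : is_adjoint ip A B -> hilbert_schmidt A ->
  exists t : R, forall e, onb ip e ->
    hs_sum A e n @[n --> \oo] --> t /\ hs_sum B e n @[n --> \oo] --> t.
Proof.
move=> aA [c Ac]; have [f of_] := onb_exists.
have cA : cvgn (hs_sum A f).
  apply: nondecreasing_is_cvgn; first exact: hs_sum_mono.
  by exists c => _ [n _ <-]; apply: Ac; exact: onb_orthosys.
exists (limn (hs_sum A f)) => e oe.
(* Two passages through the adjoint lead back to [A], but in the basis [e]. *)
have Bf := hs_sum_adj_cvg aA of_ of_ cA.
by split; [exact: hs_sum_adj_cvg (adjC aA) of_ oe Bf|exact: hs_sum_adj_cvg aA of_ oe cA].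
Qed.

(** Polarization, 4<u, v> = |u + v|^2 - |u - v|^2, reduces this to sums of squares, which agree for
    an operator and its adjoint. It is the source of the cyclicity of the trace. *)
Lemma hs_ip_cvg P P' Q Q' : is_adjoint ip P P' -> is_adjoint ip Q Q' ->
  hilbert_schmidt P -> hilbert_schmidt Q ->
  exists t : R, forall e, onb ip e ->
    \sum_(i < n) ip (P (e i)) (Q (e i)) @[n --> \oo] --> t /\
    \sum_(i < n) ip (P' (e i)) (Q' (e i)) @[n --> \oo] --> t.
Proof.
move=> aP aQ hP hQ.
have [aS hS] := hs_lin 1 aP aQ hP hQ; have [s Hs] := hs_sum_cvg aS hS.
have [aT hT] := hs_lin (-1) aP aQ hP hQ; have [t Ht] := hs_sum_cvg aT hT.
have E (A B : H -> H) (e : nat -> H) n : \sum_(i < n) ip (A (e i)) (B (e i)) =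
    4^-1 * (hs_sum (fun x => A x + 1 *: B x) e n -
            hs_sum (fun x => A x + (-1) *: B x) e n).
  rewrite /hs_sum -sumrB mulr_sumr; apply: eq_bigr => i _.
  by rewrite !ipE (ipC (B _)); field.
exists (4^-1 * (s - t)) => e oe; have [s1 s2] := Hs e oe; have [t1 t2] := Ht e oe.
split; [rewrite (funext (E P Q e))|rewrite (funext (E P' Q' e))];
  by apply: cvgMl_tmp; apply: cvgB.
Qed.

(** For C = Q' P, polar decomposition gives |C| = V C, and <V Q' P e, e> = <P e, Q V' e> is the
    general term of a series summed by [hs_ip_cvg]. *)
Lemma trace_class_hs_comp P P' Q Q' : is_adjoint ip P P' -> is_adjoint ip Q Q' ->
  hilbert_schmidt P -> hilbert_schmidt Q -> trace_class ip (Q' \o P).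
Proof.
move=> aP aQ hP hQ; have hQ' := hs_adj aQ hQ.
have bC : bounded_op ip (Q' \o P).
  exact: bounded_comp (hs_bounded (adjC aQ) hQ') (hs_bounded aP hP).
have aC : is_adjoint ip (Q' \o P) (P' \o Q) by exact: adj_comp (adjC aQ) aP.
have hCC : psd_op ip ((P' \o Q) \o (Q' \o P)).
  split.
  - apply: bounded_comp => //; apply: bounded_comp; last exact: hs_bounded hQ.
    by apply: hs_bounded (adjC aP) _; exact: hs_adj hP.
  - by apply: adj_comp => //; exact: adjC.
  - by move=> x; have := ip_ge0 ((Q' \o P) x); rewrite -{1}(adjC aC).
have [[bS aS pS] SS] := sqrt_op_psd hCC; set S := sqrt_op _ _ in bS aS pS SS.
have [e oe] := onb_exists.
split => //; exists (P' \o Q), e; split => //.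
have CS x : ip ((Q' \o P) x) ((Q' \o P) x) = ip (S x) (S x).
  by rewrite -aS aC (_ : S (S x) = (S \o S) x)// SS ipC.
have [V [V' [aV bV bV' VC _]]] := polar aC aS CS.
have [t Ht] := hs_ip_cvg aP (adj_comp aQ (adjC aV)) hP
  (hs_compr aQ (adjC aV) bV hQ).
have [Ht1 _] := Ht e oe; apply: (cvgP t).
move: Ht1; apply: cvg_trans; apply: near_eq_cvg; apply: nearW => n.
rewrite /series/= big_mkord; apply: eq_bigr => i _.
by rewrite -/S -VC aV [RHS]/= -(adjC aQ).
Qed.

Lemma has_trace_hs_comp P P' Q Q' : is_adjoint ip P P' -> is_adjoint ip Q Q' ->
  hilbert_schmidt P -> hilbert_schmidt Q ->
  exists t, has_trace ip (Q' \o P) t /\ has_trace ip (P \o Q') t.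
Proof.
move=> aP aQ hP hQ; have [t Ht] := hs_ip_cvg aP aQ hP hQ; exists t; split.
  split; first exact: trace_class_hs_comp.
  move=> e /Ht[h _]; move: h; apply: cvg_trans; apply: near_eq_cvg.
  by apply: nearW => n; rewrite /series/= big_mkord; apply: eq_bigr => i _ /=;
    rewrite -(adjC aQ).
split.
  by apply: (trace_class_hs_comp (adjC aQ) (adjC aP)); exact: hs_adj; eassumption.
move=> e /Ht[_ h]; move: h; apply: cvg_trans; apply: near_eq_cvg.
by apply: nearW => n; rewrite /series/= big_mkord; apply: eq_bigr => i _ /=;
  rewrite aP ipC.
Qed.

(** * Optimality for Hilbert-Schmidt factors *)

Lemma optimal_prepushforward_hs A1 B1 A2 B2 M :
  is_adjoint ip A1 B1 -> is_adjoint ip A2 B2 ->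
  hilbert_schmidt A1 -> hilbert_schmidt A2 ->
  psd_op ip (B1 \o A2) -> (forall x, A1 x = 0 -> A2 x = 0) ->
  (forall x, M (A1 x) = A2 x) ->
  optimal_prepushforward ip (A1 \o B1) (A2 \o B2) (range A1) M.
Proof.
move=> a1 a2 h1 h2 [_ sC pC] null MA.
have l1 := adj_linear a1; have l2 := adj_linear a2.
have b1 := hs_bounded a1 h1; have b2 := hs_bounded a2 h2.
have cov A B : is_adjoint ip A B -> hilbert_schmidt A -> covariance_op ip (A \o B).
  move=> aA hA; have hB := hs_adj aA hA; split.
    split; [exact: bounded_comp (hs_bounded aA hA) (hs_bounded (adjC aA) hB)|
      exact: adj_comp aA (adjC aA)|by move=> x; rewrite /= aA ip_ge0].
  exact: (trace_class_hs_comp (adjC aA) (adjC aA)).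
have [cov1 _] := cov _ _ a1 h1.
have [hS SS] := sqrt_op_psd cov1; have [bS aS pS] := hS.
rewrite /optimal_prepushforward; set S := sqrt_op ip (A1 \o B1) in hS SS bS aS pS *.
have SSx x : S (S x) = A1 (B1 x) by rewrite -[RHS]/((A1 \o B1) x) -SS.
have [U [V [aU bU bV US VB]]] := polar aS (adjC a1) (fun x =>
  etrans (esym (aS (S x) x)) (etrans (congr1 (ip ^~ x) (SSx x)) (a1 (B1 x) x))).
have SV x : S (V x) = A1 x.
  by apply: ip_ext => z; rewrite aS (adjC aU) US a1.
have AU x : A1 (U x) = S x.
  by apply: ip_ext => z; rewrite a1 aU VB aS.
have A2UV x : A2 (U (V x)) = A2 x.
  apply/subr0_eq; rewrite -(linB l2); apply: null.
  by rewrite (linB l1) AU SV subrr.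
(* Here the possibly unbounded [M] is traded for a bounded operator with adjoint [V \o B2]. *)
have MS x : M (S x) = A2 (U x) by rewrite -AU MA.
pose M' := S \o (A2 \o U).
have M'E : S \o M \o S = M' by apply/funext => x; rewrite /M' /= MS.
have VS x : V (B1 x) = S x := VB x.
have aM' : is_adjoint ip M' (V \o (B2 \o S)).
  exact: adj_comp aS (adj_comp a2 aU).
have M'C x : M' x = V ((B1 \o A2) (U x)) by rewrite /M' /= -VS.
have sM' : is_adjoint ip M' M'.
  by move=> x y; rewrite !M'C (adjC aU) sC aU.
have M'adj x : V (B2 (S x)) = M' x.
  by apply: ip_ext => z; rewrite [RHS]sM' (adjC aM').
have hM' : psd_op ip M'.
  split => //; last by move=> x; rewrite M'C (adjC aU) pC.
  by apply: bounded_comp => //; exact: bounded_comp.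
have hAU : hilbert_schmidt (A2 \o U) by exact: hs_compr h2.
have hSS : hilbert_schmidt S.
  have -> : S = A1 \o U by apply/funext => x; rewrite /= AU.
  exact: hs_compr h1.
have [t [t1 t2]] := has_trace_hs_comp (adj_comp a2 aU) aS hAU hSS.
split.
- by split; [exact: cov a1 h1|exact: cov a2 h2].
- apply/seteqP; split => _ [x _ <-]; first by exists (V x) => //; rewrite SV.
  by exists (U x) => //; rewrite AU.
- move=> a _ _ [x _ <-] [y _ <-].
  by rewrite -(linZ l1) -(linD l1) !MA (linD l2) (linZ l2).
- exists (V \o B2).
    by move=> x y; rewrite /= MS a2 aU.
  by apply/funext => x /=; rewrite MS A2UV.
- exists t; split; first by rewrite M'E.
    have -> : M \o (A1 \o B1) = (A2 \o U) \o S.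
      by apply/funext => x /=; rewrite MA US.
    exact: t2.
  (* By symmetry the inner [M'] is replaced by its adjoint V B2 S, and A2 then absorbs U V. *)
  have M'2 x : M' (M' x) = S (A2 (B2 (S x))) by rewrite -(M'adj x) /M' /= A2UV.
  by rewrite (sqrt_opE hM')//; apply/funext => x; exact: M'2.
Qed.

End separable.
End hilbert.

(** * The Hilbert space of square-integrable functions *)

Section L2_hilbert.
Context d (T : measurableType d) (R : realType).
Variable mu : {measure set T -> \bar R}.
Implicit Types (f g : T -> R) (u v : L2 mu).

Lemma ae_eq_Rintegral f g : measurable_fun [set: T] f ->
  measurable_fun [set: T] g -> (\forall x \ae mu, f x = g x) ->
  \int[mu]_x f x = \int[mu]_x g x.
Proof.
move=> mf mg fg; congr fine; apply: ae_eq_integral => //.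
- exact/measurable_EFinP.
- exact/measurable_EFinP.
- by move: fg; apply: filterS => x -> _.
Qed.

Lemma L2_measurable u : measurable_fun [set: T] (u : T -> R).
Proof. by have /Lfun2P[] := L2_Lfun u. Qed.

Lemma Lfun2_mul_integrable f g : f \in Lfun mu 2%:E -> g \in Lfun mu 2%:E ->
  mu.-integrable [set: T] (fun x => (f x * g x)%:E).
Proof. by move=> fL gL; apply/Lfun1_integrable; exact: Lfun2_mul_Lfun1. Qed.

Lemma L2_mul_integrable u v : mu.-integrable [set: T] (fun x => (u x * v x)%:E).
Proof. by apply: Lfun2_mul_integrable; exact: L2_Lfun. Qed.

Lemma L2_innerE u : (L2_inner u u)%:E = (\int[mu]_x (u x ^+ 2)%:E)%E.
Proof.
rewrite /L2_inner /Rintegral fineK; last first.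
  exact: integrable_fin_num (L2_mul_integrable u u).
by apply: eq_integral => x _; rewrite expr2.
Qed.

Lemma L2_inner_class (h : LfunType mu (lee1n 2)) v :
  L2_inner (L2_class h) v = \int[mu]_x (h x * v x).
Proof.
apply: ae_eq_Rintegral.
- by apply: measurable_funM; exact: L2_measurable.
- by apply: measurable_funM; [exact: measurable_funPT|exact: L2_measurable].
- by move: (L2_class_ae h); apply: filterS => x ->.
Qed.

Lemma L2_innerC u v : L2_inner u v = L2_inner v u.
Proof. by apply: eq_Rintegral => x _; rewrite mulrC. Qed.

Lemma L2_inner_linear a u v w :
  L2_inner (a *: u + v) w = a * L2_inner u w + L2_inner v w.
Proof.
rewrite /L2_inner -RintegralZl//; last exact: L2_mul_integrable.
rewrite -RintegralD//; last exact: L2_mul_integrable; last first.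
  have := integrableZl measurableT a (L2_mul_integrable u w).
  exact.
apply: ae_eq_Rintegral.
- by apply: measurable_funM; exact: L2_measurable.
- by apply: measurable_funD; [apply: measurable_funM => //|];
    apply: measurable_funM; exact: L2_measurable.
- move: (L2_addE (a *: u) v) (L2_scaleE a u); apply: filterS2 => x -> ->.
  by rewrite mulrDl mulrA.
Qed.

Lemma L2_inner_ge0 u : 0 <= L2_inner u u.
Proof. by apply: Rintegral_ge0 => x _; rewrite -expr2 sqr_ge0. Qed.

Lemma L2_inner_eq0 u : L2_inner u u = 0 -> u = 0.
Proof.
move=> u0; apply/L2_eqP.
have mu2 : measurable_fun [set: T] (fun x => (u x ^+ 2)%:E).
  by apply/measurable_EFinP/measurable_funX; exact: L2_measurable.
have /(ae_eq_integral_abs mu measurableT mu2) h : (\int[mu]_x `|(u x ^+ 2)%:E| = 0)%E.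
  rewrite -[RHS]/(0%:E) -u0 L2_innerE; apply: eq_integral => x _.
  by rewrite gee0_abs// lee_fin sqr_ge0.
move: h (L2_zeroE mu); apply: filterS2 => x /(_ I)[] /eqP.
by rewrite sqrf_eq0 => /eqP -> ->.
Qed.

End L2_hilbert.

(** * Completeness (Riesz-Fischer) *)

Section L2_complete.
Context d (T : measurableType d) (R : realType).
Variable mu : {finite_measure set T -> \bar R}.
Implicit Types (f g : T -> R) (u : L2 mu) (v : nat -> L2 mu).

Lemma L2_subE (u v : L2 mu) : \forall x \ae mu, (u - v) x = u x - v x.
Proof.
move: (L2_addE u (- v)) (L2_oppE v); apply: filterS2 => x uv v'.
by rewrite uv v'.
Qed.

Lemma L2_inner_sub (u v : L2 mu) : (L2_inner (u - v) (u - v))%:E =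
  (\int[mu]_x ((u x - v x) ^+ 2)%:E)%E.
Proof.
rewrite L2_innerE; apply: ge0_ae_eq_integral => //.
- by apply/measurable_EFinP/measurable_funX; exact: L2_measurable.
- by apply/measurable_EFinP/measurable_funX/measurable_funB; exact: L2_measurable.
- by move=> x _; rewrite lee_fin sqr_ge0.
- by move=> x _; rewrite lee_fin sqr_ge0.
- by move: (L2_subE u v); apply: filterS => x -> _.
Qed.

(** Cauchy-Schwarz against the constant 1; [fine] loses nothing because [mu] is finite. *)
Lemma L2_integral_norm_le u : (\int[mu]_x `|u x|%:E <=
  (hnorm (@L2_inner _ _ _ mu) u * Num.sqrt (fine (mu [set: T])))%:E)%E.
Proof.
have mu' : measurable_fun [set: T] (fun x => `|u x|).
  by apply: measurableT_comp => //; exact: L2_measurable.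
have iu : mu.-integrable [set: T] (fun x => `|u x|%:E).
  apply/Lfun1_integrable/Lfun_norm/Lfun_subset12; first exact: fin_num_measure.
  exact: L2_Lfun.
have := Rintegral_cauchy_schwarz mu mu' (measurable_cst (1 : R)).
have -> : \int[mu]_x (`|u x| * cst 1 x) = \int[mu]_x `|u x|.
  by apply: eq_Rintegral => x _; rewrite mulr1.
have -> : (\int[mu]_x (`|u x| ^+ 2)%:E = (L2_inner u u)%:E)%E.
  by rewrite L2_innerE; apply: eq_integral => x _; rewrite real_normK ?num_real.
have -> : (\int[mu]_x ((cst 1 x : R) ^+ 2)%:E = (fine (mu [set: T]))%:E)%E.
  rewrite fineK ?fin_num_measure//.
  under eq_integral do rewrite expr1n.
  by rewrite integral_cst// mul1e.
rewrite -EFinM lee_fin => h.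
have -> : (\int[mu]_x `|u x|%:E)%E = (\int[mu]_x `|u x|)%:E.
  by rewrite /Rintegral fineK// integrable_fin_num.
rewrite lee_fin -ler_sqr ?nnegrE ?mulr_ge0 ?sqrtr_ge0 ?Rintegral_ge0//.
by rewrite exprMn !sqr_sqrtr ?L2_inner_ge0 ?fine_ge0.
Qed.

(** Carries the Cauchy bounds over to the limit [w], which at this stage is a function not yet known
    to be square-integrable. *)
Lemma L2_fatou v (w : T -> R) u (c : R) : measurable_fun [set: T] w ->
  (\forall x \ae mu, v n x @[n --> \oo] --> w x) ->
  (forall n, L2_inner (v n - u) (v n - u) <= c) ->
  (\int[mu]_x ((w x - u x) ^+ 2)%:E <= c%:E)%E.
Proof.
move=> mw vw vc.
pose f n x : \bar R := ((v n x - u x) ^+ 2)%:E.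
have mf n : measurable_fun [set: T] (f n).
  by apply/measurable_EFinP/measurable_funX/measurable_funB; exact: L2_measurable.
have f0 n x : [set: T] x -> (0 <= f n x)%E by rewrite lee_fin sqr_ge0.
have -> : (\int[mu]_x ((w x - u x) ^+ 2)%:E = \int[mu]_x limn_einf (f^~ x))%E.
  apply: ae_eq_integral => //.
  - apply/measurable_EFinP/measurable_funX/measurable_funB => //.
    exact: L2_measurable.
  - have -> : (fun x => limn_einf (f^~ x)) = (fun x => - limn_esup (fun n => - f n x))%E.
      apply/funext => x; rewrite -limn_einfN; congr limn_einf.
      by apply/funext => n; exact/esym/oppeK.
    apply: measurableT_comp => //; apply: measurable_fun_limn_esup => n.
    exact: measurableT_comp.
  - move: vw; apply: filterS => x vx _.
    have /cvg_limn_einf_sup[-> _] // : f^~ x @ \oo --> ((w x - u x) ^+ 2)%:E.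
    apply: cvg_EFin; first exact: nearW.
    have h : v n x - u x @[n --> \oo] --> w x - u x.
      by apply: cvgB => //; exact: cvg_cst.
    by rewrite /comp/= expr2; apply: (cvgM h h).
apply: le_trans (fatou mu measurableT mf f0) _.
rewrite limn_einf_lim; apply: lime_le; first exact: is_cvg_einfs.
apply: nearW => n; rewrite /einfs.
apply: (@le_trans _ _ (\int[mu]_x f n x)%E); last by rewrite -L2_inner_sub lee_fin.
by apply: ereal_inf_lbound; exists n => /=.
Qed.

(** The increments are summable in L_1, so the telescoping series converges absolutely almost
    everywhere. *)
Lemma L2_ae_cvg v :
  (forall n, hnorm (@L2_inner _ _ _ mu) (v n.+1 - v n) <= (2 ^ n.+1)%:R^-1) ->
  exists2 w : T -> R, measurable_fun [set: T] w &
    \forall x \ae mu, v n x @[n --> \oo] --> w x.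
Proof.
move=> vS.
(* The upper limit is measurable outright and equals the limit wherever the latter exists. *)
exists (fun x => fine (limn_esup (fun n => (v n x)%:E))).
  apply: (measurableT_comp (fine_measurable measurableT)).
  apply: measurable_fun_limn_esup => n; apply/measurable_EFinP.
  exact: L2_measurable.
pose D n x : \bar R := `|v n.+1 x - v n x|%:E.
have mD n : measurable_fun [set: T] (D n).
  apply/measurable_EFinP/measurableT_comp => //.
  by apply: measurable_funB; exact: L2_measurable.
have D0 n x : [set: T] x -> (0 <= D n x)%E by rewrite lee_fin.
set C := Num.sqrt (fine (mu [set: T])).
have DC n : (\int[mu]_x D n x <= (C / (2 ^ n.+1)%:R)%:E)%E.
  have -> : (\int[mu]_x D n x = \int[mu]_x `|(v n.+1 - v n) x|%:E)%E.
    apply: ge0_ae_eq_integral => //.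
    - by apply/measurable_EFinP/measurableT_comp.
    - exact: D0.
    - by move: (L2_subE (v n.+1) (v n)); apply: filterS => x -> _.
  apply: le_trans (L2_integral_norm_le _) _.
  by rewrite lee_fin mulrC ler_wpM2l ?sqrtr_ge0.
pose S x := (\sum_(0 <= n <oo) D n x)%E.
have S0 x : (0 <= S x)%E by apply: nneseries_ge0 => n _ _; exact: D0.
have mS : measurable_fun [set: T] S.
  by apply: ge0_emeasurable_sum => // n x ? _; exact: D0.
have iS : mu.-integrable [set: T] S.
  apply/integrableP; split => //.
  under eq_integral do rewrite gee0_abs//.
  rewrite integral_nneseries//.
  apply: (@le_lt_trans _ _ C%:E); last exact: ltry.
  (* The bounds form the geometric series C/2 + C/4 + ... = C. *)
  apply: le_trans (epsilon_trick0 xpredT (sqrtr_ge0 _)).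
  by apply: lee_nneseries => // n _ _; apply: integral_ge0 => x; exact: D0.
move: (integrable_ae measurableT iS); apply: filterS => x /(_ I) Sx.
have cs : cvgn (series (telescope (fun n => v n x))).
  apply: normed_cvg; apply: nondecreasing_is_cvgn.
    by move=> a b; apply: nondecreasing_series => k _ _; exact: normr_ge0.
  exists (fine (S x)) => _ [n _ <-]; rewrite -lee_fin fineK//.
  have <- : (\sum_(0 <= i < n) D i x)%E =
      ([normed series (telescope (fun n => v n x))] n)%:E.
    by rewrite /series/= -sumEFin.
  by apply: nneseries_lim_ge => k _ _; exact: D0.
have cv : cvgn (fun n => v n x).
  have -> : (fun n => v n x) =
      (fun n => v 0%N x + series (telescope (fun n => v n x)) n).
    by apply/funext => n; rewrite [LHS](eq_sum_telescope (fun n => v n x)).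
  by apply: is_cvgD => //; exact: is_cvg_cst.
have /cvg_limn_einf_sup[_ ->] // : (v n x)%:E @[n --> \oo] --> (limn (fun n => v n x))%:E.
by apply: cvg_EFin => //; exact: nearW.
Qed.

Lemma L2_complete (v : nat -> L2 mu) :
  (forall e : R, 0 < e -> exists N, forall m n, (N <= m)%N -> (N <= n)%N ->
    hnorm (@L2_inner _ _ _ mu) (v m - v n) < e) ->
  exists l, ip_cvg (@L2_inner _ _ _ mu) v l.
Proof.
move=> vC.
have pos k : 0 < (2 ^ k.+1)%:R^-1 :> R by rewrite invr_gt0 ltr0n expn_gt0.
have [N HN] := boolp.choice (fun k => vC _ (pos k)).
(* Summing makes [s] monotone and at least [N k]; the added 1 makes it at least [k]. *)
pose s k := (\sum_(i < k.+1) (N i).+1)%N.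
have Ns k : (N k <= s k)%N.
  by rewrite /s big_ord_recr/=; apply: leq_trans (leq_addl _ _).
have ks k : (k <= s k)%N.
  elim: k => // k IH; rewrite /s big_ord_recr/= addnS ltnS.
  exact: leq_trans IH (leq_addr _ _).
have ss k : (s k <= s k.+1)%N by rewrite {2}/s big_ord_recr leq_addr.
have smono : {homo s : m n / (m <= n)%N} by apply: homo_leq => //; exact: leq_trans.
have [k|w mw vw] := @L2_ae_cvg (fun k => v (s k)).
  by apply/ltW/HN; rewrite ?(leq_trans (Ns k)).
have bound e : 0 < e -> exists n0, forall n, (n0 <= n)%N ->
    (\int[mu]_x ((w x - v n x) ^+ 2)%:E <= (e ^+ 2)%:E)%E.
  move=> e0; have [n0 Hn0] := vC e e0; exists n0 => n n0n.
  (* The shift puts every index [s (j + n0)] past [n0] and keeps the limit. *)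
  apply: (@L2_fatou (fun j => v (s (j + n0)%N))) => // [|j].
    move: vw; apply: filterS => x.
    by rewrite -(cvg_shiftn n0).
  rewrite -[X in X <= _]sqr_sqrtr ?L2_inner_ge0//.
  rewrite ler_sqr ?nnegrE ?sqrtr_ge0 ?(ltW e0)//; apply/ltW/Hn0 => //.
  by apply: leq_trans (ks _); exact: leq_addl.
have [n1 Hn1] := bound 1 ltr01; have := Hn1 n1 (leqnn _).
move=> /le_lt_trans /(_ (ltry _)) fin1.
have wL : w \in Lfun mu 2%:E.
  have dL : (fun x => w x - v n1 x) \in Lfun mu 2%:E.
    by apply/Lfun2P; split => //; apply: measurable_funB => //; exact: L2_measurable.
  have -> : w = (fun x => w x - v n1 x) + (v n1 : T -> R).
    by apply/funext => x; rewrite fctE/= subrK.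
  exact: (LfunP (Lfun_Sub (lee1n 2) dL + L2_repr (v n1))).
exists (L2_class (Lfun_Sub (lee1n 2) wL)).
apply/cvgrPdist_le => e e0; have [n0 Hn0] := bound e e0.
exists n0 => // n /= /Hn0 h.
rewrite sub0r normrN ger0_norm ?sqrtr_ge0//.
rewrite -ler_sqr ?nnegrE ?sqrtr_ge0 ?(ltW e0)// sqr_sqrtr ?L2_inner_ge0//.
rewrite -lee_fin L2_inner_sub; apply: le_trans h.
rewrite le_eqVlt; apply/orP; left; apply/eqP.
apply: ge0_ae_eq_integral => //.
- by apply/measurable_EFinP/measurable_funX/measurable_funB; exact: L2_measurable.
- by apply/measurable_EFinP/measurable_funX/measurable_funB => //; exact: L2_measurable.
- by move=> x _; rewrite lee_fin sqr_ge0.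
- by move=> x _; rewrite lee_fin sqr_ge0.
- move: (L2_class_ae (Lfun_Sub (lee1n 2) wL)); apply: filterS => x -> _ /=.
  by rewrite -sqrrN opprB.
Qed.

Lemma L2_hilbert : hilbert_ip (@L2_inner _ _ _ mu).
Proof.
split.
- exact: L2_innerC.
- exact: L2_inner_linear.
- exact: L2_inner_ge0.
- exact: L2_inner_eq0.
- exact: L2_complete.
Qed.

End L2_complete.

(** * Integral operators *)

Section integral_operators.
Context d (E : measurableType d) (R : realType).
Variable mu : {finite_measure set E -> \bar R}.
Implicit Types (G H : L2kernel mu) (f g : E -> R).
Local Notation ip := (@L2_inner _ _ _ mu).

Lemma Lfun2_measurable f : f \in Lfun mu 2%:E -> measurable_fun [set: E] f.
Proof. by case/Lfun2P. Qed.

Lemma kernel_sqr_lty G : (\int[mu \x mu]_z (G z ^+ 2)%:E < +oo)%E.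
Proof. by have /Lfun2P[] := LfunP G. Qed.

Lemma kernel_sqr_measurable G :
  measurable_fun [set: E * E] (fun z => (G z ^+ 2)%:E).
Proof. by apply/measurable_EFinP/measurable_funX; exact: measurable_funPT. Qed.

Lemma kernel_sqr_fubini G : (\int[mu]_s \int[mu]_t (G (s, t) ^+ 2)%:E =
  \int[mu \x mu]_z (G z ^+ 2)%:E)%E.
Proof.
by rewrite (fubini_tonelli1 _ (kernel_sqr_measurable G))// => z; rewrite lee_fin sqr_ge0.
Qed.

Lemma kernel_section_measurable G s : measurable_fun [set: E] (fun t => G (s, t)).
Proof. by apply: (measurableT_comp (measurable_funPT G)); exact: measurable_pair1. Qed.

(** By Tonelli the squared norm of the section is integrable in s, hence finite almost
    everywhere. *)
Lemma kernel_section G :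
  \forall s \ae mu, (fun t => G (s, t)) \in Lfun mu 2%:E.
Proof.
have iG : mu.-integrable [set: E] (fun s => \int[mu]_t (G (s, t) ^+ 2)%:E)%E.
  apply/integrableP; split.
    apply: (@measurable_fun_fubini_tonelli_F _ _ E E R mu _ (kernel_sqr_measurable G)).
    by move=> z; rewrite lee_fin sqr_ge0.
  under eq_integral => s _.
    rewrite gee0_abs; last by apply: integral_ge0 => t _; rewrite lee_fin sqr_ge0.
    over.
  by rewrite kernel_sqr_fubini kernel_sqr_lty.
move: (integrable_ae measurableT iG); apply: filterS => s /(_ I) h.
apply/Lfun2P; split; first exact: kernel_section_measurable.
by rewrite -ge0_fin_numE//; apply: integral_ge0 => t _; rewrite lee_fin sqr_ge0.
Qed.

(** Turns the bilinear form of a kernel into an integral of [G] against a tensor, integrable on the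
    square, so that Fubini applies. *)
Lemma tensor_Lfun f g : f \in Lfun mu 2%:E -> g \in Lfun mu 2%:E ->
  (fun z : E * E => g z.1 * f z.2) \in Lfun (mu \x mu)%E 2%:E.
Proof.
move=> /Lfun2P[mf f2] /Lfun2P[mg g2]; apply/Lfun2P.
have mF : measurable_fun [set: E * E] (fun z : E * E => g z.1 * f z.2).
  by apply: measurable_funM; exact: measurableT_comp.
split => //; rewrite fubini_tonelli1; last 2 first.
- by apply/measurable_EFinP/measurable_funX.
- by move=> z; rewrite lee_fin sqr_ge0.
rewrite /fubini_F /=.
have mf2 : measurable_fun [set: E] (fun t => (f t ^+ 2)%:E).
  by apply/measurable_EFinP/measurable_funX.
have mg2 : measurable_fun [set: E] (fun t => (g t ^+ 2)%:E).
  by apply/measurable_EFinP/measurable_funX.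
have -> : (\int[mu]_s \int[mu]_t ((g s * f t) ^+ 2)%:E =
    \int[mu]_s ((g s ^+ 2)%:E * \int[mu]_t (f t ^+ 2)%:E))%E.
  apply: eq_integral => s _; under eq_integral do rewrite exprMn EFinM.
  by rewrite ge0_integralZl// ?lee_fin ?sqr_ge0// => t _; rewrite lee_fin sqr_ge0.
have i0 (h : E -> R) : (0 <= \int[mu]_t (h t ^+ 2)%:E)%E.
  by apply: integral_ge0 => t _; rewrite lee_fin sqr_ge0.
rewrite ge0_integralZr//; last by move=> s _; rewrite lee_fin sqr_ge0.
by rewrite lte_mul_pinfty// ge0_fin_numE.
Qed.

Section bilinear.
Context G f g (fL : f \in Lfun mu 2%:E) (gL : g \in Lfun mu 2%:E).
Let F (z : E * E) : \bar R := (G z * (g z.1 * f z.2))%:E.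

Let iF : (mu \x mu)%E.-integrable [set: E * E] F.
Proof. by apply: Lfun2_mul_integrable; [exact: LfunP|exact: tensor_Lfun]. Qed.

Let bilinear_iterated : \int[mu]_s ((\int[mu]_t (G (s, t) * f t)) * g s) =
  fine (\int[mu]_s \int[mu]_t F (s, t))%E.
Proof.
congr fine; apply: ae_eq_integral => //.
- apply/measurable_EFinP/measurable_funM; last exact: Lfun2_measurable.
  apply: (@measurable_Rintegral2 _ _ _ _ _ _ (fun z => G z * f z.2)).
  apply: measurable_funM; first exact: measurable_funPT.
  by apply: measurableT_comp => //; exact: Lfun2_measurable.
- exact: measurable_int (integrable_fubini_F iF).
move: (kernel_section G); apply: filterS => s Gs _.
have ii := Lfun2_mul_integrable Gs fL.
rewrite -RintegralZr// /Rintegral fineK.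
  by apply: eq_integral => t _; rewrite /F/= -mulrA (mulrC (f t)).
apply: integrable_fin_num => //.
have := integrableZr measurableT (g s) ii; apply: eq_integrable => // t _.
Qed.

Lemma bilinear_prod : \int[mu]_s ((\int[mu]_t (G (s, t) * f t)) * g s) =
  fine (\int[mu \x mu]_z F z)%E.
Proof. by rewrite bilinear_iterated -integral12_prod_meas1. Qed.

Lemma bilinear_FubiniF : \int[mu]_s ((\int[mu]_t (G (s, t) * f t)) * g s) =
  fine (\int[mu]_t \int[mu]_s F (s, t))%E.
Proof. by rewrite bilinear_iterated Fubini. Qed.

Lemma bilinear_FubiniE : \int[mu]_s ((\int[mu]_t (G (s, t) * f t)) * g s) =
  fine (\int[mu]_s \int[mu]_t (G (s, t) * (g s * f t))%:E)%E.
Proof. exact: bilinear_iterated. Qed.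
End bilinear.

Lemma int_op_bilinear_adj G f g : f \in Lfun mu 2%:E -> g \in Lfun mu 2%:E ->
  \int[mu]_s ((\int[mu]_t (G (s, t) * f t)) * g s) =
  \int[mu]_t ((\int[mu]_s (G (s, t) * g s)) * f t).
Proof.
move=> fL gL; rewrite bilinear_FubiniF//.
rewrite (bilinear_FubiniE (kernel_adj G) gL fL); congr fine.
apply: eq_integral => t _; apply: eq_integral => s _ /=.
by rewrite (mulrC (f t)).
Qed.

Lemma int_opE G (u : L2 mu) :
  \forall s \ae mu, int_op G u s = \int[mu]_t (G (s, t) * u t).
Proof. exact: L2_class_ae. Qed.

Lemma int_op_inner G (u v : L2 mu) : ip (int_op G u) v =
  \int[mu]_s ((\int[mu]_t (G (s, t) * u t)) * v s).
Proof. exact: L2_inner_class. Qed.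

Lemma int_op_adjoint G : is_adjoint ip (int_op G) (int_op (kernel_adj G)).
Proof.
move=> u v; rewrite [RHS]L2_innerC !int_op_inner.
by rewrite int_op_bilinear_adj//; exact: L2_Lfun.
Qed.

(** For almost every s the section G(s, .) is square-integrable, and the claim at s is the exchange
    of integrals for [H] tested against that section. *)
Lemma int_op_comp G H : int_op (kernel_comp G H) = int_op G \o int_op H.
Proof.
apply/funext => u; apply/L2_eqP.
move: (int_opE (kernel_comp G H) u) (int_opE G (int_op H u)) (kernel_section G).
apply: filterS3 => s -> /= -> Gs.
have uL := L2_Lfun u.
transitivity (\int[mu]_r ((\int[mu]_t (H (r, t) * u t)) * G (s, r))); last first.
  apply: ae_eq_Rintegral.
  - apply: measurable_funM; last exact: kernel_section_measurable.
    by have /Lfun2P[] := integral_fun_Lfun H u.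
  - apply: measurable_funM; first exact: kernel_section_measurable.
    exact: (L2_measurable (int_op H u)).
  - by move: (int_opE H u); apply: filterS => r ->; rewrite mulrC.
rewrite int_op_bilinear_adj//; apply: eq_Rintegral => t _; congr (_ * _).
by apply: eq_Rintegral => r _; rewrite mulrC.
Qed.

(** Tested against [v], both sides are integrals over the square, which do not see a null set of the
    product measure. *)
Lemma int_op_ae_eq G H : (\forall z \ae (mu \x mu)%E, G z = H z) ->
  int_op G = int_op H.
Proof.
move=> GH; apply/funext => u; apply: (ip_ext (L2_hilbert mu)) => v.
rewrite !int_op_inner !bilinear_prod; try exact: L2_Lfun.
congr fine; apply: ae_eq_integral => //.
- apply: measurable_int; apply: Lfun2_mul_integrable; first exact: LfunP.
  by apply: tensor_Lfun; exact: L2_Lfun.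
- apply: measurable_int; apply: Lfun2_mul_integrable; first exact: LfunP.
  by apply: tensor_Lfun; exact: L2_Lfun.
- by move: GH; apply: filterS => z -> _.
Qed.

(** The values (K_G e_i)(s) are the Fourier coefficients of G(s, .); Bessel bounds their squares for
    each s, and integration over s gives the squared norm of [G]. *)
Lemma int_op_hilbert_schmidt G : hilbert_schmidt ip (int_op G).
Proof.
exists (fine (\int[mu \x mu]_z (G z ^+ 2)%:E)%E) => e oe n.
have hH := L2_hilbert mu.
pose F i s : R := \int[mu]_t (G (s, t) * e i t).
have mF i : measurable_fun [set: E] (fun s => (F i s ^+ 2)%:E).
  by apply/measurable_EFinP/measurable_funX; have /Lfun2P[] := integral_fun_Lfun G (e i).
have F0 i s : [set: E] s -> (0 <= (F i s ^+ 2)%:E)%E by rewrite lee_fin sqr_ge0.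
rewrite -lee_fin fineK; last first.
  rewrite ge0_fin_numE ?kernel_sqr_lty//.
  by apply: integral_ge0 => z _; rewrite lee_fin sqr_ge0.
rewrite -kernel_sqr_fubini /hs_sum -sumEFin.
have -> : (\sum_(i < n) (ip (int_op G (e i)) (int_op G (e i)))%:E =
    \int[mu]_s \sum_(i < n) (F i s ^+ 2)%:E)%E.
  rewrite ge0_integral_sum//; last by move=> i r; exact: F0.
  apply: eq_bigr => i _; rewrite L2_innerE.
  apply: ge0_ae_eq_integral => //.
  - by apply/measurable_EFinP/measurable_funX; exact: L2_measurable.
  - by move=> s _; rewrite lee_fin sqr_ge0.
  - exact: F0.
  - by move: (int_opE G (e i)); apply: filterS => s -> _.
apply: ge0_le_integral => //.
- by move=> s _; apply: sume_ge0 => i _; exact: F0.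
- exact: emeasurable_sum.
- apply: (@measurable_fun_fubini_tonelli_F _ _ E E R mu _ (kernel_sqr_measurable G)).
  by move=> z; rewrite lee_fin sqr_ge0.
move=> s _; rewrite sumEFin.
(* The comparison is made at every s: where the section is not square-integrable the right side is
   infinite. *)
have [Gs|/negP Gs] := boolP ((fun t => G (s, t)) \in Lfun mu 2%:E); last first.
  rewrite (_ : (\int[mu]_t _)%E = +oo%E) ?leey//; apply/eqP; rewrite eq_le leey/= leNgt.
  apply/negP => h; apply: Gs; apply/Lfun2P; split=> //.
  exact: kernel_section_measurable.
pose w := L2_class (Lfun_Sub (lee1n 2) Gs).
have -> : (\int[mu]_t (G (s, t) ^+ 2)%:E)%E = (ip w w)%:E.
  rewrite L2_innerE; apply: ge0_ae_eq_integral => //.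
  - by apply/measurable_EFinP/measurable_funX; exact: kernel_section_measurable.
  - by apply/measurable_EFinP/measurable_funX; exact: L2_measurable.
  - by move=> t _; rewrite lee_fin sqr_ge0.
  - by move=> t _; rewrite lee_fin sqr_ge0.
  - by move: (L2_class_ae (Lfun_Sub (lee1n 2) Gs)); apply: filterS => t -> _.
rewrite lee_fin; apply: le_trans (bessel hH oe w n).
rewrite le_eqVlt; apply/orP; left; apply/eqP; apply: eq_bigr => i _.
by rewrite L2_inner_class.
Qed.

End integral_operators.

Theorem theorem7p3 (R : realType) (E : ptopologicalType)
    (mu : {finite_measure set (borel E) -> \bar R})
    (d1 d2 : measure_display)
    (T1 : measurableType d1) (P1 : probability T1 R)
    (T2 : measurableType d2) (P2 : probability T2 R)
    (X1 : borel E -> T1 -> R) (X2 : borel E -> T2 -> R)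
    (K1 K2 G1 G2 : L2kernel mu) :
  compact [set: E] ->
  separable_space (@L2_inner _ _ _ mu) ->
  gaussian_process P1 X1 K1 ->
  gaussian_process P2 X2 K2 ->
  is_green K1 G1 ->
  is_green K2 G2 ->
  psd_op (@L2_inner _ _ _ mu) (int_op (kernel_comp (kernel_adj G1) G2)) ->
  (forall f, int_op G1 f = 0 -> int_op G2 f = 0) ->
  leadsto K1 K2 /\
  exists M : L2 mu -> L2 mu,
    [/\ optimal_prepushforward (@L2_inner _ _ _ mu) (int_op K1) (int_op K2)
          (range (int_op G1)) M,
        forall h, range (int_op G1) h -> range (int_op G2) (M h) &
        forall f, M (int_op G1 f) = int_op G2 f].
Proof.
move=> _ sep _ _ green1 green2 psd null.
have hH := L2_hilbert mu.
have [s Hs] := separable_dense_seq sep.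
have K1E : int_op K1 = int_op G1 \o int_op (kernel_adj G1).
  by rewrite (int_op_ae_eq green1) int_op_comp.
have K2E : int_op K2 = int_op G2 \o int_op (kernel_adj G2).
  by rewrite (int_op_ae_eq green2) int_op_comp.
(* An arbitrary preimage is chosen; the inclusion of null spaces makes the value on the range
   independent of it. *)
pose M h := int_op G2 (xget 0 [set f | int_op G1 f = h]).
have ME f : M (int_op G1 f) = int_op G2 f.
  rewrite /M; case: xgetP => [g _ gf|/(_ f)[]//].
  have l1 := adj_linear hH (int_op_adjoint G1).
  have l2 := adj_linear hH (int_op_adjoint G2).
  apply/subr0_eq; rewrite -(linB l2); apply: null.
  by rewrite (linB l1) gf subrr.
have opt : optimal_prepushforward (@L2_inner _ _ _ mu) (int_op K1) (int_op K2)
    (range (int_op G1)) M.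
  rewrite K1E K2E; apply: (optimal_prepushforward_hs hH Hs) => //.
  - exact: int_op_adjoint.
  - exact: int_op_adjoint.
  - exact: int_op_hilbert_schmidt.
  - exact: int_op_hilbert_schmidt.
  - by rewrite -int_op_comp.
split; first by exists (range (int_op G1)), M.
by exists M; split => // h [f _ <-]; exists f.
Qed.
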